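(* Let $G,H$ be finitely generated groups, where $H$ is finitely presented and admits a translation-like action on $G$. (1) For every nonempty sofic $H$-subshift $Y$ there is a nonempty $G$-SFT $X$ with $m(X)\ge m(Y)$. In particular, if $H$ admits a nonempty sofic subshift with nonzero Medvedev degree, then so does $G$. (2) If $G$ is recursively presented and there is a translation-like action of $H$ on $G$ that is computable and has decidable orbit membership problem, then $\mathfrak{M}_{\mathtt{SFT}}(H)\subset\mathfrak{M}_{\mathtt{SFT}}(G)$ and $\mathfrak{M}_{\mathtt{SOF}}(H)\subset\mathfrak{M}_{\mathtt{SOF}}(G)$.
   Context: Alphabets are finite. For a group $G$ and alphabet $A$, $A^G=\{x\colon G\to A\}$ carries the prodiscrete topology and the shift action $(gx)(h)=x(g^{-1}h)$. A $G$-subshift is a closed $G$-invariant set $X\subset A^G$. For finite $F\subset G$ and a pattern $p\in A^F$ let $[p]=\{x\in A^G: x|_F=p\}$. $X$ is a subshift of finite type (SFT) if there is a finite set $\mathcal F$ of patterns with $X=\{x: gx\notin[p]\ \forall g\in G,\ p\in\mathcal F\}$. A subshift is sofic if it is the image of an SFT under a continuous $G$-equivariant map. Medvedev degrees: for $P,Q\subset\{0,1\}^{\mathbb N}$ write $P\le Q$ if there is a partial computable function $\Psi$ on $\{0,1\}^{\mathbb N}$ (a Turing functional) defined on all of $Q$ with $\Psi(Q)\subset P$. The Medvedev degree $m(P)$ is the class of $P$ under the equivalence $P\le Q\le P$; the degrees form a lattice $\mathfrak M$ with minimum $0_{\mathfrak M}$ (the degree of sets having a computable element), called zero. For a group $G$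 with finite generating set $R$, free group $F(R)$ and canonical epimorphism $\rho\colon F(R)\to G$, the pullback of a subshift $X\subset A^G$ is $\widehat X=\{x\circ\rho: x\in X\}\subset A^{F(R)}$. Via a computable bijection $\mathbb N\to F(R)$ and a fixed-length binary coding of $A$, $\widehat X$ is identified with a subset of $\{0,1\}^{\mathbb N}$, and $m(X):=m(\widehat X)$ (independent of choices). $\mathfrak{M}_{\mathtt{SFT}}(G)$ and $\mathfrak{M}_{\mathtt{SOF}}(G)$ are the sets of degrees $m(X)$ for $X$ a nonempty $G$-SFT, respectively a nonempty sofic $G$-subshift. Fix finite symmetric generating sets $R$ of $G$ and $S$ of $H$. A right action $\ast$ of $H$ on the set $G$ is translation-like if it is free and bounded, i.e. for each $s\in S$ the set $\{g^{-1}(g\ast s):g\in G\}$ is finite. It is computable if there is a computable map $R^*\times S^*\to R^*$ sending each pair of words $(u,w)$ representing $(g,h)$ to a word representing $g\ast h$; it has decidable orbit membership problem if there is an algorithm deciding, given $u,v\in R^*$, whether the elements of $G$ they represent lie in the same $H$-orbit. A finitely generated group is recursively presented if the set of words in a finite generating set representing the identity is recursively enumerable. *)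

(* Defs.v *)
From HB Require Import structures.
From mathcomp Require Import all_boot finmap.
From mathcomp Require Import boolp classical_sets functions cardinality topology.

Set Implicit Arguments.
Unset Strict Implicit.
Unset Printing Implicit Defensive.

Local Open Scope classical_set_scope.
Local Open Scope group_scope.

(** * Computability: Kleene's partial recursive functions with an oracle *)

Inductive prog : Type :=
| PZero
| PSucc
| PProj of nat
| POracle
| PComp of prog & seq prog
| PRec of prog & prog
| PMu of prog.

(* [runs x p a v]: program [p] with oracle [x] halts on the arguments [a] with
   output [v].  Missing arguments read as 0, except for the recursion argument
   of [PRec], which diverges on the empty list.  [PMu p] returns the least [n]
   such that [p] outputs 0 on [n :: a], and needs [p] to halt on all smaller
   values. *)
Inductive runs (x : nat -> bool) : prog -> seq nat -> nat -> Prop :=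
| runs_zero a : runs x PZero a 0
| runs_succ a : runs x PSucc a (nth 0 a 0).+1
| runs_proj i a : runs x (PProj i) a (nth 0 a i)
| runs_oracle a : runs x POracle a (x (nth 0 a 0) : nat)
| runs_comp p qs a bs v :
    runs_all x qs a bs -> runs x p bs v -> runs x (PComp p qs) a v
| runs_rec0 p q a v : runs x p a v -> runs x (PRec p q) (0 :: a) v
| runs_recS p q n a u v :
    runs x (PRec p q) (n :: a) u -> runs x q [:: n, u & a] v ->
    runs x (PRec p q) (n.+1 :: a) v
| runs_mu p n a (k : nat -> nat) :
    (forall i, i < n -> runs x p (i :: a) (k i).+1) ->
    runs x p (n :: a) 0 -> runs x (PMu p) a n
with runs_all (x : nat -> bool) : seq prog -> seq nat -> seq nat -> Prop :=
| runs_nil a : runs_all x [::] a [::]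
| runs_cons q qs a v vs :
    runs x q a v -> runs_all x qs a vs -> runs_all x (q :: qs) a (v :: vs).

(* Ordinary computability is computability with the constant oracle. *)
Definition no_oracle : nat -> bool := fun=> false.

Definition computable1 (f : nat -> nat) : Prop :=
  exists p, forall n, runs no_oracle p [:: n] (f n).

(* A Turing functional is the partial map [x |-> y] such that [n |-> y n] is
   computed by a fixed program with oracle [x]. *)
Definition functional (p : prog) (x y : nat -> bool) : Prop :=
  forall n, runs x p [:: n] (y n : nat).

Definition computable_point (x : nat -> bool) : Prop :=
  exists p, functional p no_oracle x.

(* Words over a finite alphabet are coded by natural numbers through MathComp's
   computable bijection [CodeSeq.code : seq nat -> nat]. *)
Definition word_code (T : finType) (w : seq T) : nat :=
  CodeSeq.code [seq (enum_rank a : nat) | a <- w].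

Definition computable_words2 (T U V : finType)
    (f : seq T -> seq U -> seq V) : Prop :=
  exists p, forall u w,
    runs no_oracle p [:: word_code u; word_code w] (word_code (f u w)).

Definition decidable_words2 (T U : finType) (P : seq T -> seq U -> Prop) : Prop :=
  exists p, forall u w,
    runs no_oracle p [:: word_code u; word_code w] (`[< P u w >] : nat).

Definition re_words (T : finType) (P : seq T -> Prop) : Prop :=
  exists p, forall w, P w <-> exists v, runs no_oracle p [:: word_code w] v.

(** * Medvedev degrees *)

Definition medvedev_le (P Q : set (nat -> bool)) : Prop :=
  exists p, forall x, Q x -> exists2 y, P y & functional p x y.

(* Degrees are equivalence classes, represented as sets of subsets of
   {0,1}^nat. *)
Definition degree : Type := set (set (nat -> bool)).

Definition degree_of (P : set (nat -> bool)) : degree :=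
  [set Q | medvedev_le P Q /\ medvedev_le Q P].

Definition degree_le (d e : degree) : Prop :=
  exists P Q, [/\ d = degree_of P, e = degree_of Q & medvedev_le P Q].

Definition zero_degree : degree :=
  [set P | exists2 x, P x & computable_point x].

(** * Groups given by generators *)

(* Signed words: the letter [(t, false)] stands for [t] and [(t, true)] for its
   inverse. *)
Definition sword (T : finType) : Type := seq (T * bool).

Definition eval_letter (T : finType) (G : groupType) (g : T -> G)
    (a : T * bool) : G :=
  if a.2 then (g a.1)^-1 else g a.1.

Definition eval_sword (T : finType) (G : groupType) (g : T -> G)
    (w : sword T) : G :=
  \prod_(a <- w) eval_letter g a.

Definition opp_letter (T : finType) (a : T * bool) : T * bool := (a.1, ~~ a.2).

Definition reduced (T : finType) (w : sword T) : bool :=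
  sorted (fun a b => b != opp_letter a) w.

(* The free group on [T], as the set of freely reduced words. *)
Definition free_group (T : finType) : Type := {w : sword T | reduced w}.

Definition generates (G : groupType) (R : {fset G}) : Prop :=
  forall g : G, exists w : sword R, eval_sword val w = g.

Definition symmetric_set (G : groupType) (R : {fset G}) : Prop :=
  forall g, g \in R -> g^-1 \in R.

Definition epi (G : groupType) (R : {fset G}) (w : free_group R) : G :=
  eval_sword val (val w).

(* Equality of signed words in the group presented by [T] and the relators
   [rels]. *)
Inductive presented_eq (T : finType) (rels : seq (sword T)) :
    sword T -> sword T -> Prop :=
| peq_refl w : presented_eq rels w w
| peq_sym v w : presented_eq rels v w -> presented_eq rels w v
| peq_trans u v w :
    presented_eq rels u v -> presented_eq rels v w -> presented_eq rels u w
| peq_cancel u v a :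
    presented_eq rels (u ++ [:: a; opp_letter a] ++ v) (u ++ v)
| peq_rel u v r :
    r \in rels -> presented_eq rels (u ++ r ++ v) (u ++ v).

Definition finitely_presented (G : groupType) : Prop :=
  exists (T : finType) (g : T -> G) (rels : seq (sword T)),
    (forall x, exists w, eval_sword g w = x) /\
    (forall w, eval_sword g w = 1 <-> presented_eq rels w [::]).

Definition recursively_presented (G : groupType) : Prop :=
  exists2 R : {fset G}, generates R &
    re_words (fun w : sword R => eval_sword val w = 1).

(** * Translation-like actions *)

Section Actions.
Variables (G H : groupType) (R : {fset G}) (S : {fset H}) (act : G -> H -> G).

Definition right_action : Prop :=
  (forall g, act g 1 = g) /\
  (forall g h k, act g (h * k) = act (act g h) k).

Definition free_action : Prop := forall g h, act g h = g -> h = 1.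

Definition bounded_action : Prop :=
  forall s, s \in S -> finite_set [set g^-1 * act g s | g in [set: G]].

Definition translation_like : Prop :=
  [/\ right_action, free_action & bounded_action].

(* Evaluation of positive words, used when the generating set is symmetric. *)
Definition eval_word (K : groupType) (Q : {fset K}) (w : seq Q) : K :=
  \prod_(r <- w) val r.

Definition computable_action : Prop :=
  exists2 f : seq R -> seq S -> seq R, computable_words2 f &
    forall u w, eval_word (f u w) = act (eval_word u) (eval_word w).

Definition decidable_orbit_membership : Prop :=
  decidable_words2 (fun u v : seq R =>
    exists h, eval_word v = act (eval_word u) h).

End Actions.

(** * Subshifts *)

(* The full shift A^G with the prodiscrete topology. *)
Notation config G A := {ptws G -> discrete_topology A}.

Section Subshifts.
Variable G : groupType.

Definition shift (A : finType) (g : G) (x : config G A) : config G A :=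
  fun h => x (g^-1 * h).

Definition subshift (A : finType) (X : set (config G A)) : Prop :=
  closed X /\ forall g x, X x -> X (shift g x).

(* A pattern with support F is a finite map with domain F. *)
Definition cylinder (A : finType) (p : {fmap G -> A}) : set (config G A) :=
  [set x | forall h, h \in domf p -> p.[? h]%fmap = Some (x h)].

Definition SFT (A : finType) (X : set (config G A)) : Prop :=
  subshift X /\
  exists F : {fset {fmap G -> A}},
    X = [set x | forall g p, p \in F -> ~ cylinder p (shift g x)].

Definition sofic (A : finType) (X : set (config G A)) : Prop :=
  subshift X /\
  exists (B : finType) (Z : set (config G B)) (f : config G B -> config G A),
    [/\ SFT Z,
        {within Z, continuous f},
        forall g x, Z x -> f (shift g x) = shift g (f x)
      & X = f @` Z].

(** * Medvedev degrees of subshifts *)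

(* A computable bijection between nat and the free group; none exists if [T]
   is empty. *)
Definition computable_bijection (T : finType) (nu : nat -> free_group T) : Prop :=
  bijective nu /\ computable1 (fun n => word_code (val (nu n))).

(* The k-th symbol of A is coded by the block of length #|A| whose only 1 is in
   position k; the block of the element [nu i] starts at position i * #|A|. *)
Definition bits (T A : finType) (nu : nat -> free_group T)
    (y : free_group T -> A) : nat -> bool :=
  fun n => (enum_rank (y (nu (n %/ #|A|))) : nat) == n %% #|A|.

Definition pullback (R : {fset G}) (A : finType) (X : set (config G A)) :
    set (free_group R -> A) :=
  [set x \o @epi G R | x in X].

Definition subshift_degree (R : {fset G}) (nu : nat -> free_group R)
    (A : finType) (X : set (config G A)) : degree :=
  degree_of (bits nu @` pullback (R := R) X).

Definition degrees_SFT (R : {fset G}) (nu : nat -> free_group R) : set degree :=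
  [set d | exists (A : finType) (X : set (config G A)),
     [/\ SFT X, X !=set0 & d = subshift_degree nu X]].

Definition degrees_sofic (R : {fset G}) (nu : nat -> free_group R) : set degree :=
  [set d | exists (A : finType) (X : set (config G A)),
     [/\ sofic X, X !=set0 & d = subshift_degree nu X]].

End Subshifts.

(* Main.v *)
(* A translation-like action of H on G moves every generator of H by finitely
   many displacements, so it is recorded by arrows labelled in a finite subset J
   of G. For an H-subshift Z, the lift of Z consists of the configurations of
   arrows satisfying the relators of H, decorated with symbols that form a point
   of Z along every orbit of the resulting (possibly non-free) action. As H is
   finitely presented this is an SFT when Z is one; reading a lifted point along
   the orbit of the identity computes a point of Z. Conversely, freeness of the
   given action lets one copy a point of Z on every orbit through a cocycle
   c : G -> H with c (g * h) = c g h. If the action is computable with decidable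
   orbit membership, taking as base point of each orbit its first element in the
   enumeration of G makes c computable, by an unbounded search that uses only the
   semi-decidability of equality in G. *)
Require Import Defs.
From mathcomp Require Import all_boot finmap.
From mathcomp Require Import boolp classical_sets functions cardinality topology.

Set Implicit Arguments.
Unset Strict Implicit.
Unset Printing Implicit Defensive.

Local Open Scope classical_set_scope.

Scheme runs_mut := Minimality for runs Sort Prop
  with runs_all_mut := Minimality for runs_all Sort Prop.

Lemma prog_ind_seq (P : prog -> Prop) (Q : seq prog -> Prop) :
  P PZero -> P PSucc -> (forall i, P (PProj i)) -> P POracle ->
  (forall p qs, P p -> Q qs -> P (PComp p qs)) ->
  (forall p q, P p -> P q -> P (PRec p q)) ->
  (forall p, P p -> P (PMu p)) ->
  Q [::] -> (forall p qs, P p -> Q qs -> Q (p :: qs)) ->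
  forall p, P p.
Proof.
move=> h0 hS hp ho hc hr hm hn hq; fix IH 1.
case=> [||i||p qs|p q|p]; [exact: h0|exact: hS|exact: hp|exact: ho| | |].
- apply: hc; first exact: IH.
  by elim: qs => [|q qs IHqs]; [exact: hn|apply: hq; [exact: IH|exact: IHqs]].
- by apply: hr; exact: IH.
- by apply: hm; exact: IH.
Qed.

(** * Oracle substitution *)

Fixpoint subst_oracle (q p : prog) : prog :=
  match p with
  | POracle => PComp q [:: PProj 0]
  | PComp r qs => PComp (subst_oracle q r) (map (subst_oracle q) qs)
  | PRec r s => PRec (subst_oracle q r) (subst_oracle q s)
  | PMu r => PMu (subst_oracle q r)
  | _ => p
  end.

Lemma runs_subst_oracle (x y : nat -> bool) (q p : prog) a v :
  functional q x y -> runs y p a v -> runs x (subst_oracle q p) a v.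
Proof.
move=> qxy; apply: (@runs_mut y (fun p a v => runs x (subst_oracle q p) a v)
  (fun ps a vs => runs_all x (map (subst_oracle q) ps) a vs)) => /=;
  try by constructor.
- move=> b; apply: runs_comp (qxy _).
  by do 2!constructor.
- by move=> {}p qs b bs w _ IHqs _ IHp; apply: runs_comp IHqs IHp.
- by move=> {}p q2 n b u w _ IH1 _ IH2; apply: runs_recS IH1 IH2.
- by move=> {}p n b k _ IH1 _ IH2; apply: runs_mu IH1 IH2.
Qed.

Lemma runs_no_oracle (x : nat -> bool) (p : prog) a v :
  runs no_oracle p a v -> runs x (subst_oracle PZero p) a v.
Proof. by apply: runs_subst_oracle => n; constructor. Qed.

Lemma medvedev_le_refl (P : set (nat -> bool)) : medvedev_le P P.
Proof. by exists POracle => x Px; exists x => // n; constructor. Qed.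

Lemma medvedev_le_trans (P Q Q' : set (nat -> bool)) :
  medvedev_le P Q -> medvedev_le Q Q' -> medvedev_le P Q'.
Proof.
move=> [p pP] [q qP]; exists (subst_oracle q p) => x /qP[y Qy qxy].
have [z Pz pyz] := pP y Qy; exists z => // n.
exact: runs_subst_oracle (pyz n).
Qed.

Lemma degree_ofE (P Q : set (nat -> bool)) :
  medvedev_le P Q -> medvedev_le Q P -> degree_of P = degree_of Q.
Proof.
move=> PQ QP; rewrite /degree_of; apply/seteqP; split=> Q' [] le1 le2; split.
- exact: medvedev_le_trans QP le1.
- exact: medvedev_le_trans le2 PQ.
- exact: medvedev_le_trans PQ le1.
- exact: medvedev_le_trans le2 QP.
Qed.

Lemma degree_of_eq0 (P : set (nat -> bool)) :
  degree_of P = zero_degree <-> exists2 x, P x & computable_point x.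
Proof.
split=> [P0|[x Px [p px]]].
  have: degree_of P P by split; exact: medvedev_le_refl.
  by rewrite P0.
rewrite /degree_of; apply/seteqP; split=> Q.
  case=> _ [q qP]; have [y Qy qxy] := qP x Px; exists y => //.
  by exists (subst_oracle p q) => n; exact: runs_subst_oracle (qxy n).
case=> y Qy [q qy]; split.
  by exists (subst_oracle PZero p) => z _; exists x => // n; exact: runs_no_oracle.
by exists (subst_oracle PZero q) => z _; exists y => // n; exact: runs_no_oracle.
Qed.

(** * Total functions computable from an oracle *)

(* [env k] is an oracle together with [k] numbers; nested pairs let the
   recursion and minimisation schemes bind a variable by extending the
   environment. *)
Fixpoint env (k : nat) : Type :=
  if k is k'.+1 then (env k' * nat)%type else (nat -> bool).

Fixpoint oracle (k : nat) : env k -> nat -> bool :=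
  if k is k'.+1 then fun e => oracle e.1 else id.

Fixpoint args (k : nat) : env k -> seq nat :=
  if k is k'.+1 then fun e => e.2 :: args e.1 else fun=> [::].

Definition computable (k : nat) (f : env k -> nat) : Prop :=
  exists p, forall e, runs (oracle e) p (args e) (f e).

Lemma size_args k (e : env k) : size (args e) = k.
Proof. by elim: k e => //= k IHk e; rewrite IHk. Qed.

Lemma eq_computable k (f g : env k -> nat) :
  f =1 g -> computable f -> computable g.
Proof. by move=> fg [p pf]; exists p => e; rewrite -fg. Qed.

Lemma computable_arg k i : computable (fun e : env k => nth 0 (args e) i).
Proof. by exists (PProj i) => e; constructor. Qed.

Lemma computable_subst j k (s : env k -> env j) (f : env j -> nat) :
  (forall e, oracle (s e) = oracle e) ->
  (forall i, computable (fun e => nth 0 (args (s e)) i)) ->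
  computable f -> computable (fun e => f (s e)).
Proof.
move=> so /choice[q qs] [p pf]; exists (PComp p (map q (iota 0 j))) => e.
apply: runs_comp (_ : runs _ p (args (s e)) _); last by rewrite -so; exact: pf.
suff {p pf} all m n : runs_all (oracle e) (map q (iota m n)) (args e)
    [seq nth 0 (args (s e)) i | i <- iota m n].
  have := all 0 j; rewrite -[X in map (nth _ _) (iota 0 X)](size_args (s e)).
  by rewrite map_nth_iota0 // take_size.
by elim: n m => [|n IHn] m /=; constructor.
Qed.

Lemma computable_wk k (f : env k -> nat) :
  computable f -> computable (fun e : env k.+1 => f e.1).
Proof.
by apply: (@computable_subst k k.+1 fst) => // i; exact: (computable_arg k.+1 i.+1).
Qed.

Lemma computable_wk2 k (f : env k -> nat) :
  computable f -> computable (fun e : env k.+2 => f e.1.1).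
Proof. by move/computable_wk/computable_wk. Qed.

Lemma computable_let k (f : env k -> nat) (g : env k -> nat -> nat) :
  computable f -> computable (fun e : env k.+1 => g e.1 e.2) ->
  computable (fun e => g e (f e)).
Proof.
move=> cf; apply: (@computable_subst k.+1 k (fun e => (e, f e))) => // -[|i] //.
exact: computable_arg.
Qed.

Lemma computable_var k : computable (fun e : env k.+1 => e.2).
Proof. exact: (computable_arg k.+1 0). Qed.

Lemma computable_var1 k : computable (fun e : env k.+2 => e.1.2).
Proof. exact: (computable_arg k.+2 1). Qed.

Lemma computable_var2 k : computable (fun e : env k.+3 => e.1.1.2).
Proof. exact: (computable_arg k.+3 2). Qed.

Lemma computable_lift k (m : nat -> nat) (f : env k -> nat) :
  computable (fun e : env 1 => m e.2) -> computable f ->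
  computable (fun e => m (f e)).
Proof.
move=> cm cf; apply: (@computable_subst 1 k (fun e => (oracle e, f e))) cm => //.
case=> // i; apply: (eq_computable (f := fun=> 0)); first by move=> e; rewrite /= nth_nil.
by exists PZero => e; constructor.
Qed.

Lemma computable_S k (f : env k -> nat) :
  computable f -> computable (fun e => (f e).+1).
Proof.
apply: (computable_lift (m := S)); exists PSucc => e.
exact: (runs_succ _ (_ :: _)).
Qed.

Lemma computable_const k (n : nat) : computable (fun _ : env k => n).
Proof.
elim: n => [|n IHn]; first by exists PZero => e; constructor.
exact: computable_S.
Qed.

Lemma computable_oracle k (f : env k -> nat) :
  computable f -> computable (fun e => oracle e (f e) : nat).
Proof.
move=> [p pf]; exists (PComp POracle [:: p]) => e.
apply: runs_comp (runs_oracle _ [:: f e]).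
by apply: runs_cons (pf e) (runs_nil _ _).
Qed.

Lemma computable_iteri k (n f : env k -> nat) (g : env k -> nat -> nat -> nat) :
  computable n -> computable f ->
  computable (fun e : env k.+2 => g e.1.1 e.2 e.1.2) ->
  computable (fun e => iteri (n e) (g e) (f e)).
Proof.
move=> cn [p pf] [q qg].
apply: (computable_let (g := fun e m => iteri m (g e) (f e)) cn).
exists (PRec p q) => -[e m] /=; elim: m => [|m IHm]; first exact: runs_rec0.
exact: runs_recS IHm (qg (e, _, _)).
Qed.

Lemma computable_mu k (h : env k -> nat) (g : env k -> nat -> nat) :
  computable (fun e : env k.+1 => g e.1 e.2) ->
  (forall e, g e (h e) = 0) -> (forall e i, i < h e -> g e i != 0) ->
  computable h.
Proof.
move=> [p pg] g0 gN0; exists (PMu p) => e.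
apply: (@runs_mu _ _ _ _ (fun i => (g e i).-1)) => [i ltih|].
  by have := pg (e, i); rewrite /= prednK // lt0n gN0.
by have := pg (e, h e); rewrite /= g0.
Qed.

Lemma computable_add k (f g : env k -> nat) :
  computable f -> computable g -> computable (fun e => f e + g e).
Proof.
move=> cf cg; apply: (@eq_computable _ (fun e => iteri (g e) (fun=> S) (f e))).
  by move=> e; elim: (g e) => [|n /= ->]; rewrite ?addn0 ?addnS.
by apply: computable_iteri => //; exact/computable_S/computable_var1.
Qed.

Lemma computable_mul k (f g : env k -> nat) :
  computable f -> computable g -> computable (fun e => f e * g e).
Proof.
move=> cf cg; apply: (@eq_computable _ (fun e => iteri (g e) (fun _ s => s + f e) 0)).
  by move=> e; elim: (g e) => [|n /= ->]; rewrite ?muln0 // mulnSr.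
apply: computable_iteri => //; first exact: computable_const.
by apply: computable_add; [exact: computable_var1|exact: (computable_wk2 cf)].
Qed.

Lemma computable_pred k (f : env k -> nat) :
  computable f -> computable (fun e => (f e).-1).
Proof.
move=> cf; apply: (@eq_computable _ (fun e => iteri (f e) (fun i _ => i) 0)).
  by move=> e; case: (f e).
by apply: computable_iteri; [|exact: computable_const|exact: computable_var].
Qed.

Lemma computable_sub k (f g : env k -> nat) :
  computable f -> computable g -> computable (fun e => f e - g e).
Proof.
move=> cf cg; apply: (@eq_computable _ (fun e => iteri (g e) (fun=> predn) (f e))).
  by move=> e; elim: (g e) => [|n /= ->]; rewrite ?subn0 // subnS.
by apply: computable_iteri => //; exact/computable_pred/computable_var1.
Qed.

Lemma computable_eq0 k (f : env k -> nat) :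
  computable f -> computable (fun e => (f e == 0) : nat).
Proof.
move=> cf; apply: (@eq_computable _ (fun e => 1 - f e)); first by move=> e; case: (f e).
by apply: computable_sub => //; exact: computable_const.
Qed.

Lemma computable_leq k (f g : env k -> nat) :
  computable f -> computable g -> computable (fun e => (f e <= g e) : nat).
Proof. by move=> cf cg; apply: computable_eq0; exact: computable_sub. Qed.

Lemma computable_neg k (b : env k -> bool) :
  computable (fun e => b e : nat) -> computable (fun e => ~~ b e : nat).
Proof.
by move/computable_eq0; apply: eq_computable => e; case: (b e).
Qed.

Lemma computable_and k (b c : env k -> bool) :
  computable (fun e => b e : nat) -> computable (fun e => c e : nat) ->
  computable (fun e => b e && c e : nat).
Proof.
move=> cb cc; apply: (@eq_computable _ (fun e => b e * c e)).
  by move=> e; rewrite mulnb.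
exact: computable_mul.
Qed.

Lemma computable_or k (b c : env k -> bool) :
  computable (fun e => b e : nat) -> computable (fun e => c e : nat) ->
  computable (fun e => b e || c e : nat).
Proof.
move=> cb cc; apply: (@eq_computable _ (fun e => ~~ (~~ b e && ~~ c e) : nat)).
  by move=> e; rewrite negb_and !negbK.
by apply/computable_neg/computable_and; exact: computable_neg.
Qed.

Lemma computable_eq k (f g : env k -> nat) :
  computable f -> computable g -> computable (fun e => (f e == g e) : nat).
Proof.
move=> cf cg; apply: (@eq_computable _ (fun e => (f e <= g e) && (g e <= f e) : nat)).
  by move=> e; rewrite eqn_leq.
by apply: computable_and; exact: computable_leq.
Qed.

Lemma computable_if k (b : env k -> bool) (f g : env k -> nat) :
  computable (fun e => b e : nat) -> computable f -> computable g ->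
  computable (fun e => if b e then f e else g e).
Proof.
move=> cb cf cg; apply: (@eq_computable _ (fun e => b e * f e + (~~ b e) * g e)).
  by move=> e; case: (b e); rewrite ?mul1n ?mul0n ?addn0.
by apply: computable_add; apply: computable_mul => //; exact: computable_neg.
Qed.

Lemma computable_exp k (f g : env k -> nat) :
  computable f -> computable g -> computable (fun e => f e ^ g e).
Proof.
move=> cf cg; apply: (@eq_computable _ (fun e => iteri (g e) (fun _ s => f e * s) 1)).
  by move=> e; elim: (g e) => [|n /= ->]; rewrite ?expn0 // expnS.
apply: computable_iteri => //; first exact: computable_const.
by apply: computable_mul; [exact: (computable_wk2 cf)|exact: computable_var1].
Qed.

Lemma computable_divn k (f g : env k -> nat) :
  computable f -> computable g -> computable (fun e => f e %/ g e).
Proof.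
move=> cf cg; apply: (@computable_mu _ _
    (fun e q => ~~ ((g e == 0) || (f e < q.+1 * g e)) : nat)).
- apply/computable_neg/computable_or.
    by apply/computable_eq0/computable_wk.
  apply: computable_leq; first exact/computable_S/computable_wk.
  by apply: computable_mul; [exact/computable_S/computable_var|exact: computable_wk].
- by move=> e; case: (posnP (g e)) => //= g0; rewrite ltn_ceil.
- move=> e i; case: (posnP (g e)) => [->|g0 /=]; first by rewrite divn0.
  by rewrite leq_divRL // => le; rewrite eqb0 negbK -leqNgt.
Qed.

Lemma computable_modn k (f g : env k -> nat) :
  computable f -> computable g -> computable (fun e => f e %% g e).
Proof.
move=> cf cg; apply: (@eq_computable _ (fun e => f e - f e %/ g e * g e)).
  by move=> e; rewrite [X in X - _](divn_eq (f e) (g e)) addKn.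
by apply/computable_sub/computable_mul => //; exact: computable_divn.
Qed.

(** * Codes of sequences *)

Lemma code_gt0 n s : 0 < CodeSeq.code (n :: s).
Proof. by rewrite /= muln_gt0 expn_gt0. Qed.

Lemma code_eq0 s : (CodeSeq.code s == 0) = (s == [::]).
Proof. by case: s => // n s; rewrite gtn_eqF // code_gt0. Qed.

Lemma size_leq_code s : size s <= CodeSeq.code s.
Proof.
elim: s => //= n s IHs; rewrite (leq_trans (_ : _ <= (CodeSeq.code s).*2.+1)) //.
  by rewrite ltnS (leq_trans IHs) // -addnn leq_addr.
by rewrite leq_pmull ?expn_gt0.
Qed.

Lemma computable_code_cons k (f g : env k -> nat) :
  computable f -> computable g ->
  computable (fun e => CodeSeq.code (f e :: CodeSeq.decode (g e))).
Proof.
move=> cf cg; apply: (@eq_computable _ (fun e => 2 ^ f e * (2 * g e).+1)).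
  by move=> e /=; rewrite CodeSeq.decodeK mul2n.
apply: computable_mul; first by apply: computable_exp => //; exact: computable_const.
by apply/computable_S/computable_mul => //; exact: computable_const.
Qed.

Lemma computable_decode_head k (f : env k -> nat) :
  computable f -> computable (fun e => head 0 (CodeSeq.decode (f e))).
Proof.
move=> cf; apply: (@computable_mu _ _ (fun e r =>
    ~~ ((f e == 0) || (f e %% 2 ^ r.+1 != 0)) : nat)).
- apply/computable_neg/computable_or; first exact/computable_eq0/computable_wk.
  apply/computable_neg/computable_eq0/computable_modn; first exact: computable_wk.
  by apply: computable_exp; [exact: computable_const|exact/computable_S/computable_var].
- move=> e; have := CodeSeq.decodeK (f e).
  case: (CodeSeq.decode _) => [|n s] <- //=; rewrite expnSr -muln_modr modn2 /= odd_double.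
  by rewrite !muln_eq0 !expn_eq0 /=.
- move=> e i; have := CodeSeq.decodeK (f e).
  case: (CodeSeq.decode _) => [|n s] <- //= lt.
  rewrite muln_eq0 expn_eq0 /= eqb0 !negbK.
  by rewrite -[_ == 0]/(dvdn _ _) dvdn_mulr // dvdn_exp2l.
Qed.

Lemma computable_decode_behead k (f : env k -> nat) :
  computable f ->
  computable (fun e => CodeSeq.code (behead (CodeSeq.decode (f e)))).
Proof.
move=> cf; apply: (@eq_computable _
    (fun e => f e %/ 2 ^ (head 0 (CodeSeq.decode (f e))).+1)).
  move=> e; have := CodeSeq.decodeK (f e).
  case: (CodeSeq.decode _) => [|n s] <- /=; first by rewrite div0n.
  by rewrite expnSr divnMl ?expn_gt0 // -mul2n -addn1 mulnC divnMDl // addn0.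
apply: computable_divn => //; apply: computable_exp; first exact: computable_const.
exact/computable_S/computable_decode_head.
Qed.

Lemma iteri_foldl (T S : Type) (x0 : T) (g : S -> T -> S) z s n :
  iteri n (fun i z => if i < size s then g z (nth x0 s i) else z) z =
  foldl g z (take n s).
Proof.
elim: n => [|n /= ->]; first by rewrite take0.
case: ltnP => [lt|ge]; last by rewrite !take_oversize // leqW.
by rewrite (take_nth x0) // foldl_rcons.
Qed.

Lemma computable_decode_drop k (f n : env k -> nat) :
  computable f -> computable n ->
  computable (fun e => CodeSeq.code (drop (n e) (CodeSeq.decode (f e)))).
Proof.
move=> cf cn; apply: (@eq_computable _ (fun e => iteri (n e)
    (fun _ c => CodeSeq.code (behead (CodeSeq.decode c))) (f e))).
  move=> e; elim: (n e) => [|m /= ->]; first by rewrite drop0 CodeSeq.decodeK.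
  by rewrite CodeSeq.codeK -drop1 drop_drop.
apply: computable_iteri => //.
exact/computable_decode_behead/computable_var1.
Qed.

Lemma computable_decode_nth k (f n : env k -> nat) :
  computable f -> computable n ->
  computable (fun e => nth 0 (CodeSeq.decode (f e)) (n e)).
Proof.
move=> cf cn; apply: (@eq_computable _ (fun e =>
    head 0 (CodeSeq.decode (CodeSeq.code (drop (n e) (CodeSeq.decode (f e))))))).
  by move=> e; rewrite CodeSeq.codeK -nth0 nth_drop addn0.
exact/computable_decode_head/computable_decode_drop.
Qed.

Lemma computable_decode_foldl k (h f : env k -> nat) (g : env k -> nat -> nat -> nat) :
  computable h -> computable f ->
  computable (fun e : env k.+2 => g e.1.1 e.1.2 e.2) ->
  computable (fun e => foldl (g e) (f e) (CodeSeq.decode (h e))).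
Proof.
move=> ch cf cg; apply: (@eq_computable _ (fun e => iteri (h e) (fun i z =>
    if i < size (CodeSeq.decode (h e))
    then g e z (nth 0 (CodeSeq.decode (h e)) i) else z) (f e))).
  move=> e; rewrite (iteri_foldl 0) take_oversize //.
  by rewrite (leq_trans (size_leq_code _)) // CodeSeq.decodeK.
have ch2 : computable (fun e : env k.+2 => h e.1.1).
  exact: computable_wk2.
apply: computable_iteri => //; apply: (@computable_if _
    (fun e : env k.+2 => e.2 < size (CodeSeq.decode (h e.1.1)))).
- apply: (@eq_computable _ (fun e : env k.+2 => ~~ (CodeSeq.code
      (drop e.2 (CodeSeq.decode (h e.1.1))) == 0) : nat)).
    move=> e; rewrite code_eq0 -size_eq0 size_drop subn_eq0.
    by rewrite leqNgt negbK.
  apply/computable_neg/computable_eq0/computable_decode_drop => //.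
  exact: computable_var.
- apply: (@computable_let k.+2 (fun e => nth 0 (CodeSeq.decode (h e.1.1)) e.2)
    (fun e n => g e.1.1 e.1.2 n)).
    by apply: computable_decode_nth => //; exact: computable_var.
  apply: (@computable_subst k.+2 k.+3 (fun e => (e.1.1.1, e.1.1.2, e.2))) cg => //.
  case=> [|[|i]] /=; [exact: computable_var|exact: computable_var2|].
  exact: (computable_arg k.+3 i.+3).
- exact: computable_var1.
Qed.

(** * Finite alphabets and words *)

Notation rank t := (nat_of_ord (enum_rank t)).

Definition switch (T : finType) (n : nat) (g : T -> nat) : nat :=
  if [pick t : T | rank t == n] is Some t then g t else 0.

Lemma switch_rank (T : finType) (t : T) (g : T -> nat) : switch (rank t) g = g t.
Proof.
rewrite /switch; case: pickP => [u /eqP/ord_inj/enum_rank_inj -> //|/(_ t)].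
by rewrite eqxx.
Qed.

Lemma computable_switch (T : finType) k (f : env k -> nat) (g : T -> env k -> nat) :
  computable f -> (forall t, computable (g t)) ->
  computable (fun e => switch (f e) (g^~ e)).
Proof.
move=> cf cg.
pose sw s e := foldr (fun t n => if f e == rank t then g t e else n) 0 s.
apply: (@eq_computable _ (sw (enum T))) => [e|]; last first.
  elim: (enum T) => [|t s IHs]; first exact: computable_const.
  apply: (@computable_if _ (fun e => f e == rank t)) => //.
  by apply: computable_eq => //; exact: computable_const.
rewrite /switch /sw; case: pickP => [t /eqP <-|no].
  have: t \in enum T by rewrite mem_enum.
  elim: (enum T) => //= u s IHs; rewrite inE; case: eqVneq => [->|tu] /=.
    by rewrite eqxx.
  by move/IHs ->; case: eqP => // /ord_inj/enum_rank_inj/eqP; rewrite (negPf tu).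
by elim: (enum T) => //= t s ->; have := no t; rewrite eq_sym => ->.
Qed.

Lemma computable_case (T : finType) k (f : env k -> T) (g : T -> env k -> nat) :
  computable (fun e => rank (f e)) -> (forall t, computable (g t)) ->
  computable (fun e => g (f e) e).
Proof.
move=> cf cg; apply: (@eq_computable _ (fun e => switch (rank (f e)) (g^~ e))).
  by move=> e; rewrite switch_rank.
exact: computable_switch.
Qed.

Lemma computable_fin (T : finType) (g : T -> nat) k (f : env k -> T) :
  computable (fun e => rank (f e)) -> computable (fun e => g (f e)).
Proof.
by move=> cf; apply: (computable_case (g := fun t _ => g t)) => // t; exact: computable_const.
Qed.

Lemma computable_map (I : Type) (T : finType) (s : seq I) k (f : I -> env k -> T)
    (g : seq T -> nat) :
  (forall i, computable (fun e => rank (f i e))) ->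
  computable (fun e => g [seq f i e | i <- s]).
Proof.
move=> cf; elim: s g => [|i s IHs] g /=; first exact: computable_const.
apply: (computable_case (g := fun t e => g (t :: [seq f j e | j <- s]))) => // t.
exact: (IHs (fun l => g (t :: l))).
Qed.

Lemma decode_word_code (T : finType) (w : seq T) :
  CodeSeq.decode (word_code w) = [seq rank a | a <- w].
Proof. by rewrite /word_code CodeSeq.codeK. Qed.

Lemma computable_word_foldl (T : finType) (S : Type) (es : S -> nat) k
    (w : env k -> seq T) (z : env k -> S) (f : env k -> S -> T -> S) :
  computable (fun e => word_code (w e)) -> computable (fun e => es (z e)) ->
  (forall t, exists g : env k -> nat -> nat,
     computable (fun e : env k.+1 => g e.1 e.2) /\
     forall e s, g e (es s) = es (f e s t)) ->
  computable (fun e => es (foldl (f e) (z e) (w e))).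
Proof.
move=> cw cz /choice[g gP].
apply: (@eq_computable _ (fun e => foldl (fun n r => switch r (fun t => g t e n))
    (es (z e)) (CodeSeq.decode (word_code (w e))))).
  move=> e; rewrite decode_word_code; elim: (w e) (z e) => //= a u IHu s.
  by rewrite switch_rank; have [_ ->] := gP a.
apply: (@computable_decode_foldl k _ _
    (fun e n r => switch r (fun t => g t e n))) => //.
apply: (@computable_switch _ k.+2 (fun e => e.2) (fun t e => g t e.1.1 e.1.2)).
  exact: computable_var.
move=> t; have [cg _] := gP t.
by apply: (computable_wk (f := fun e : env k.+1 => g t e.1 e.2)).
Qed.

Lemma computable_word_cat (T : finType) (u : seq T) k (f : env k -> nat) :
  computable f ->
  computable (fun e => CodeSeq.code ([seq rank a | a <- u] ++ CodeSeq.decode (f e))).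
Proof.
move=> cf; elim: u => [|a u IHu] /=.
  by apply: eq_computable cf => e; rewrite CodeSeq.decodeK.
have := computable_code_cons (computable_const k (rank a)) IHu.
by apply: eq_computable => e; rewrite CodeSeq.codeK.
Qed.

Section Prepend.
Variables (T U : finType) (f : T -> seq U).

Definition prepend (acc : seq U) (w : seq T) : seq U :=
  foldl (fun acc a => f a ++ acc) acc w.

Lemma prependE acc w : prepend acc w = flatten (map f (rev w)) ++ acc.
Proof.
elim: w acc => // a w IHw acc; rewrite [LHS]IHw rev_cons map_rcons flatten_rcons.
by rewrite catA.
Qed.

Lemma computable_prepend k (acc : env k -> seq U) (w : env k -> seq T) :
  computable (fun e => word_code (acc e)) -> computable (fun e => word_code (w e)) ->
  computable (fun e => word_code (prepend (acc e) (w e))).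
Proof.
move=> cacc cw.
apply: (@computable_word_foldl T (seq U) (@word_code U) k w acc
         (fun _ acc a => f a ++ acc)) => // t.
exists (fun _ n => CodeSeq.code ([seq rank a | a <- f t] ++ CodeSeq.decode n)); split.
  by apply: computable_word_cat; exact: computable_var.
by move=> e s; rewrite decode_word_code -map_cat.
Qed.

End Prepend.

Lemma computable_rev (T : finType) k (w : env k -> seq T) :
  computable (fun e => word_code (w e)) ->
  computable (fun e => word_code (rev (w e))).
Proof.
move=> cw; have := @computable_prepend T T (fun a => [:: a]) k (fun=> [::]) w
  (computable_const _ _) cw.
apply: eq_computable => e; rewrite prependE cats0; congr word_code.
by elim: (rev _) => //= a u ->.
Qed.

Lemma computable_flatmap (T U : finType) (f : T -> seq U) k (w : env k -> seq T) :
  computable (fun e => word_code (w e)) ->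
  computable (fun e => word_code (flatten (map f (w e)))).
Proof.
move=> cw; have := @computable_prepend T U f k (fun=> [::]) (fun e => rev (w e))
  (computable_const _ _) (computable_rev cw).
by apply: eq_computable => e; rewrite prependE cats0 revK.
Qed.

Lemma computable1P (f : nat -> nat) k (g : env k -> nat) :
  computable1 f -> computable g -> computable (fun e => f (g e)).
Proof.
move=> [p pf]; apply: computable_lift; exists (subst_oracle PZero p) => -[x n].
exact: runs_no_oracle (pf n).
Qed.

Lemma computable_words2P (T U V : finType) (f : seq T -> seq U -> seq V) k
    (u : env k -> seq T) (w : env k -> seq U) :
  computable_words2 f ->
  computable (fun e => word_code (u e)) -> computable (fun e => word_code (w e)) ->
  computable (fun e => word_code (f (u e) (w e))).
Proof.
move=> [p pf] [q qu] [r rw]; exists (PComp (subst_oracle PZero p) [:: q; r]) => e.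
apply: runs_comp (runs_no_oracle _ (pf _ _)).
exact: runs_cons (qu e) (runs_cons (rw e) (runs_nil _ _)).
Qed.

Lemma computable_decidable_words2 (T U : finType) (P : seq T -> seq U -> Prop) k
    (u : env k -> seq T) (w : env k -> seq U) :
  decidable_words2 P ->
  computable (fun e => word_code (u e)) -> computable (fun e => word_code (w e)) ->
  computable (fun e => `[< P (u e) (w e) >] : nat).
Proof.
move=> [p pP] [q qu] [r rw]; exists (PComp (subst_oracle PZero p) [:: q; r]) => e.
apply: runs_comp (runs_no_oracle _ (pP _ _)).
exact: runs_cons (qu e) (runs_cons (rw e) (runs_nil _ _)).
Qed.

(** * Semi-decidability *)

(* Evaluation of a program without oracle, with at most [t] steps in each
   unbounded search: [0] stands for divergence and [v.+1] for the output [v]. *)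
Fixpoint bounded_eval (t : nat) (p : prog) (a : seq nat) : nat :=
  match p with
  | PZero | POracle => 1
  | PSucc => (nth 0 a 0).+2
  | PProj i => (nth 0 a i).+1
  | PComp p qs =>
      let vs := [seq bounded_eval t q a | q <- qs] in
      if all (leq 1) vs then bounded_eval t p (map predn vs) else 0
  | PRec p q =>
      if a is n :: a' then
        iteri n (fun i u =>
          if u == 0 then 0 else bounded_eval t q [:: i, u.-1 & a'])
          (bounded_eval t p a')
      else 0
  | PMu p =>
      (iteri t (fun i s =>
         if s == 0 then
           let v := bounded_eval t p (i :: a) in
           if v == 0 then 1 else if v == 1 then i.+2 else 0
         else s) 0).-1
  end.

Lemma iteri_search (v : nat -> nat) m :
  let s := iteri m (fun i s => if s == 0 then
      if v i == 0 then 1 else if v i == 1 then i.+2 else 0 else s) 0 in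
  if s == 0 then forall i, i < m -> 1 < v i
  else if s == 1 then exists2 n, n < m & v n = 0 /\ forall i, i < n -> 1 < v i
  else s.-2 < m /\ v s.-2 = 1 /\ forall i, i < s.-2 -> 1 < v i.
Proof.
elim: m => //= m; case: (iteri m _ 0) => [|[|s]] /=.
- case vm: (v m) => [|[|r]] //= IHm; first by exists m => //.
  by move=> i; rewrite ltnS leq_eqVlt => /predU1P[->|/IHm //]; rewrite vm.
- by case=> n ltnm nP; exists n => //; exact: leqW.
- by case=> lt ?; split; first exact: leqW.
Qed.

Lemma bounded_eval_sound t p a v :
  bounded_eval t p a = v.+1 -> runs no_oracle p a v.
Proof.
move: p a v; apply: (@prog_ind_seq
  (fun p => forall a v, bounded_eval t p a = v.+1 -> runs no_oracle p a v)
  (fun qs => forall a, let vs := [seq bounded_eval t q a | q <- qs] in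
     all (leq 1) vs -> runs_all no_oracle qs a (map predn vs))) => /=.
- by move=> a v [<-]; constructor.
- by move=> a v [<-]; constructor.
- by move=> i a v [<-]; constructor.
- by move=> a v [<-]; exact: runs_oracle.
- move=> p qs IHp IHqs a v; case: ifP => // /IHqs qsP /IHp.
  exact: runs_comp qsP.
- move=> p q IHp IHq [|n a] v //.
  elim: n v => [|n IHn] v /=; first by move/IHp; constructor.
  by case: (iteri n _ _) IHn => //= u IHn /IHq; apply: runs_recS; exact: IHn.
- move=> p IHp a v.
  have /= := iteri_search (fun i => bounded_eval t p (i :: a)) t.
  case: (iteri t _ 0) => [|[|n]] //= [_ [/IHp pn lt]] [<-].
  apply: (@runs_mu _ _ _ _ (fun i => (bounded_eval t p (i :: a)).-2)) => // i /lt lti.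
  by apply: IHp; case: bounded_eval lti => [|[]].
- by move=> a _; constructor.
- move=> p qs IHp IHqs a /andP[pa /IHqs]; apply: runs_cons.
  by apply: IHp; rewrite prednK.
Qed.

Lemma bounded_eval_complete p a v : runs no_oracle p a v ->
  exists t0, forall t, t0 <= t -> bounded_eval t p a = v.+1.
Proof.
move: p a v; apply: (@runs_mut no_oracle
  (fun p a v => exists t0, forall t, t0 <= t -> bounded_eval t p a = v.+1)
  (fun qs a vs => exists t0, forall t, t0 <= t ->
     [seq bounded_eval t q a | q <- qs] = map S vs)); try by exists 0.
- move=> p qs a bs v _ [t0 IHqs] _ [t1 IHp]; exists (maxn t0 t1) => t.
  rewrite geq_max => /andP[/IHqs /= -> /IHp <-].
  by rewrite ifT; [rewrite -map_comp map_id|elim: (bs)].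
- by move=> p q a v _ [t0 IH]; exists t0 => t /IH /= ->.
- move=> p q n a u v _ [t0 IH0] _ [t1 IH1]; exists (maxn t0 t1) => t.
  by rewrite geq_max => /andP[/IH0 /= -> /IH1 /= ->].
- move=> p n a k _ IHk _ [t0 IHn].
  have /choice[f fP] : forall i, exists t0, i < n -> forall t, t0 <= t ->
      bounded_eval t p (i :: a) = (k i).+2.
    by move=> i; case: (ltnP i n) => [/IHk[t1 t1P]|]; [exists t1|exists 0].
  exists (maxn (maxn t0 n.+1) (\max_(i < n) f i)) => t.
  rewrite !geq_max -andbA => /and3P[/IHn {}IHn ltn /bigmax_leqP max].
  have {}fP i : i < n -> bounded_eval t p (i :: a) = (k i).+2.
    by move=> lti; apply: fP => //; exact: (max (Ordinal lti)).
  have /= := iteri_search (fun i => bounded_eval t p (i :: a)) t.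
  case: (iteri t _ 0) => [|[|m]] /=.
  + by move/(_ n ltn); rewrite IHn.
  + case=> m _ [m0 lt]; case: (ltngtP m n) => [/fP|/lt|mn]; rewrite ?m0 ?IHn //.
    by rewrite mn IHn in m0.
  + case=> _ [m1 lt]; case: (ltngtP m n) => [/fP|/lt|-> //]; rewrite ?m1 ?IHn //.
- by move=> q qs a v vs _ [t0 IH0] _ [t1 IH1]; exists (maxn t0 t1) => t;
  rewrite geq_max => /andP[/IH0 /= -> /IH1 /= ->].
Qed.

Fixpoint mkenv (x : nat -> bool) (j : nat) (l : nat -> nat) : env j :=
  if j is j'.+1 then (mkenv x j' (l \o S), l 0) else x.

Lemma oracle_mkenv x j l : oracle (mkenv x j l) = x.
Proof. by elim: j l => //= j IHj l; rewrite IHj. Qed.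

Lemma args_mkenv x j l : args (mkenv x j l) = mkseq l j.
Proof.
elim: j l => //= j IHj l; rewrite IHj /mkseq /= -[in RHS](addn0 1) iotaDl -map_comp.
by congr cons; apply: eq_map.
Qed.

Lemma computable_bounded_eval p k :
  computable (fun e : env k.+1 => bounded_eval e.2 p (args e.1)).
Proof.
have arg1 k' i : computable (fun e : env k'.+1 => nth 0 (args e.1) i).
  exact: (computable_arg k'.+1 i.+1).
move: p k; apply: (@prog_ind_seq
  (fun p => forall k, computable (fun e : env k.+1 => bounded_eval e.2 p (args e.1)))
  (fun qs => forall k,
     computable (fun e : env k.+1 => all (leq 1) [seq bounded_eval e.2 q (args e.1) | q <- qs] : nat)
     /\ forall i, computable (fun e : env k.+1 =>
         nth 0 [seq bounded_eval e.2 q (args e.1) | q <- qs] i))) => /=.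
- by move=> k; exact: computable_const.
- by move=> k; do 2!apply: computable_S.
- by move=> i k; apply: computable_S.
- by move=> k; exact: computable_const.
- move=> p qs IHp IHqs k; have [call cnth] := IHqs k.
  apply: (@computable_if _ (fun e : env k.+1 => all (leq 1) _)) => //; last first.
    exact: computable_const.
  pose s (e : env k.+1) : env (size qs).+1 := (mkenv (oracle e) (size qs)
    (fun i => (nth 0 [seq bounded_eval e.2 q (args e.1) | q <- qs] i).-1), e.2).
  have cs i : computable (fun e => nth 0 (args (s e)) i).
    case: i => [|i]; first exact: computable_var.
    case: (ltnP i (size qs)) => [lti|gei].
      apply: (eq_computable _ (computable_pred (cnth i))) => e.
      by rewrite /= args_mkenv nth_mkseq.
    apply: (eq_computable _ (computable_const k.+1 0)) => e.
    by rewrite /= args_mkenv nth_default // size_mkseq.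
  have so e : oracle (s e) = oracle e by rewrite /= oracle_mkenv.
  apply: (eq_computable _ (computable_subst so cs (IHp (size qs)))) => e /=.
  congr bounded_eval; rewrite args_mkenv.
  apply: (@eq_from_nth _ 0) => [|i]; rewrite size_mkseq ?size_map // => lti.
  by rewrite nth_mkseq // [RHS](nth_map 0) ?size_map ?(leq_trans lti).
- move=> p q IHp IHq [|k]; first exact: computable_const.
  apply: (@computable_iteri k.+2 (fun e => e.1.2) (fun e => bounded_eval e.2 p (args e.1.1))
    (fun e i u => if u == 0 then 0 else bounded_eval e.2 q [:: i, u.-1 & args e.1.1])).
  + exact: computable_var1.
  + apply: (@computable_subst k.+1 k.+2 (fun e => (e.1.1, e.2)) _ _ _ (IHp k)) => //.
    by case=> [|i]; [exact: computable_var|exact: (computable_arg k.+2 i.+2)].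
  + apply: (@computable_if _ (fun e : env k.+4 => e.1.2 == 0)).
    * by apply: computable_eq0; exact: computable_var1.
    * exact: computable_const.
    * apply: (@computable_subst k.+3 k.+4
        (fun e => (e.1.1.1.1, e.1.2.-1, e.2, e.1.1.2)) _ _ _ (IHq k.+2)) => //.
      case=> [|[|[|i]]] /=.
      - exact: computable_var2.
      - exact: computable_var.
      - by apply: computable_pred; exact: computable_var1.
      - exact: (computable_arg k.+4 i.+4).
- move=> p IHp k; apply: computable_pred.
  apply: (@computable_iteri k.+1 (fun e => e.2) (fun=> 0) (fun e i s => if s == 0 then
      if bounded_eval e.2 p (i :: args e.1) == 0 then 1
      else if bounded_eval e.2 p (i :: args e.1) == 1 then i.+2 else 0 else s)).
  + exact: computable_var.
  + exact: computable_const.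
  + have cv : computable (fun e : env k.+3 =>
        bounded_eval e.1.1.2 p (e.2 :: args e.1.1.1)).
      apply: (@computable_subst k.+2 k.+3
        (fun e => (e.1.1.1, e.2, e.1.1.2)) _ _ _ (IHp k.+1)) => //.
      case=> [|[|i]] /=; [exact: computable_var2|exact: computable_var|].
      exact: (computable_arg k.+3 i.+3).
    apply: (@computable_if _ (fun e : env k.+3 => e.1.2 == 0)).
    * by apply: computable_eq0; exact: computable_var1.
    * apply: (@computable_if _ (fun e : env k.+3 => bounded_eval _ _ _ == 0)).
      - exact: computable_eq0.
      - exact: computable_const.
      - apply: (@computable_if _ (fun e : env k.+3 => bounded_eval _ _ _ == 1)).
        + by apply: computable_eq => //; exact: computable_const.
        + by do 2!apply: computable_S; exact: computable_var.
        + exact: computable_const.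
    * exact: computable_var1.
- move=> k; split=> [|i]; first exact: computable_const.
  by apply: (eq_computable _ (computable_const _ 0)) => e; rewrite nth_nil.
- move=> p qs IHp IHqs k; have [call cnth] := IHqs k; split.
    apply: (@computable_and _ (fun e : env k.+1 => 0 < bounded_eval _ _ _)) => //.
    by apply: computable_leq => //; exact: computable_const.
  by case=> [|i] //=; exact: IHp.
Qed.

Lemma re_wordsP (T : finType) (P : seq T -> Prop) : re_words P ->
  exists2 b : nat -> nat -> bool, computable (fun e : env 2 => b e.1.2 e.2 : nat) &
    forall w, P w <-> exists t, b (word_code w) t.
Proof.
move=> [p pP]; exists (fun c t => bounded_eval t p [:: c] != 0).
  apply/computable_neg/computable_eq0; exact: (computable_bounded_eval p 1).
move=> w; rewrite pP; split=> [[v /bounded_eval_complete[t tP]]|[t tP]].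
  by exists t; rewrite tP.
by exists (bounded_eval t p [:: word_code w]).-1; apply: (@bounded_eval_sound t);
  rewrite prednK // lt0n.
Qed.

Lemma computable_search k (B : env k -> nat -> nat -> bool) :
  computable (fun e : env k.+2 => B e.1.1 e.1.2 e.2 : nat) ->
  (forall e, exists n s, B e n s) ->
  exists2 h : env k -> nat, computable h & forall e, exists s, B e (h e) s.
Proof.
move=> cB exB.
pose D m := CodeSeq.decode m.
have exm e : exists m, B e (head 0 (D m)) (nth 0 (D m) 1).
  have [n [s Bns]] := exB e; exists (CodeSeq.code [:: n; s]).
  by rewrite /D CodeSeq.codeK.
exists (fun e => head 0 (D (ex_minn (exm e)))); last first.
  by move=> e; case: ex_minnP => m Bm _; exists (nth 0 (D m) 1).
apply: computable_decode_head; apply: (@computable_mu _ _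
  (fun e m => ~~ B e (head 0 (D m)) (nth 0 (D m) 1) : nat)).
- apply: computable_neg; apply: (@computable_subst k.+2 k.+1
    (fun e => (e.1, head 0 (D e.2), nth 0 (D e.2) 1))) cB => //.
  case=> [|[|i]] /=.
  + by apply: computable_decode_nth; [exact: computable_var|exact: computable_const].
  + by apply: computable_decode_head; exact: computable_var.
  + exact: (computable_arg k.+1 i.+1).
- by move=> e; case: ex_minnP => m ->.
- move=> e i; case: ex_minnP => m _ min lt; rewrite eqb0 negbK.
  by apply/negP => /min; rewrite leqNgt lt.
Qed.

(** * The prodiscrete topology *)

Section Prodiscrete.
Variables (G : groupType) (A : finType).
Implicit Types (x y : config G A) (X : set (config G A)) (D : seq G).

Lemma nbhs_configP x (U : set (config G A)) :
  nbhs x U <-> exists D, forall y, {in D, x =1 y} -> U y.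
Proof.
pose F : set_system (config G A) :=
  [set V | exists D, forall y, {in D, x =1 y} -> V y].
have FF : Filter F.
  split; first by exists [::].
  - move=> V W [D DV] [E EW]; exists (D ++ E) => y xy; split.
      by apply: DV => g gD; apply: xy; rewrite mem_cat gD.
    by apply: EW => g gE; apply: xy; rewrite mem_cat gE orbT.
  - by move=> V W VW [D DV]; exists D => y /DV/VW.
split=> [xU|[D DU]].
  suff cvF : F --> x by exact: cvF xU.
  apply/cvg_sup => g V [_ [[W oW <-] Wx] /filterS]; apply.
  by exists [:: g] => y xy; rewrite /= -xy ?inE.
elim: D U DU => [|g D IHD] U DU.
  by rewrite (_ : U = setT); [exact: filterT|apply/seteqP; split=> // y _; exact: DU].
have nD : nbhs x [set y : config G A | {in D, x =1 y}] by apply: IHD.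
have ng : nbhs x [set y : config G A | y g = x g].
  exact: (@proj_continuous G (fun=> discrete_topology A) g x _ (discrete_set1 _)).
apply: filterS (filterI ng nD) => y [yg yD]; apply: DU => h.
by rewrite inE => /predU1P[->|/yD].
Qed.

Lemma closed_configP X :
  closed X <-> forall x, (forall D, exists2 y, X y & {in D, x =1 y}) -> X x.
Proof.
split=> clX x clx.
  apply: clX => U /nbhs_configP[D DU]; have [y Xy xy] := clx D.
  by exists y; split=> //; exact: DU.
apply: clX => D; have [|y [Xy xy]] := clx [set y : config G A | {in D, x =1 y}].
  by apply/nbhs_configP; exists D.
by exists y.
Qed.

Lemma compact_config : compact [set: config G A].
Proof.
have := @tychonoff G (fun=> discrete_topology A) (fun=> setT).
rewrite (_ : [set f | _] = setT); last by apply/seteqP.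
apply=> _; apply: finite_compact; exact: (@finite_finset A setT).
Qed.

Lemma uniform_window (V : Type) X (f : config G A -> V) :
  closed X ->
  (forall x, X x -> exists D, forall y, X y -> {in D, x =1 y} -> f x = f y) ->
  exists D, forall x y, X x -> X y -> {in D, x =1 y} -> f x = f y.
Proof.
move=> clX locf.
pose U D : set (config G A) := [set x : config G A | forall y z, X y -> X z ->
  {in D, x =1 y} -> {in D, x =1 z} -> f y = f z].
have cX : compact X by exact: subclosed_compact clX compact_config _.
pose F : set_system (seq G) := [set V | exists D0, forall D, {subset D0 <= D} -> V D].
have FF : Filter F.
  split; first by exists [::].
  - move=> P Q [D DV] [E EW]; exists (D ++ E) => D' sD; split.
      by apply: DV => g gD; apply: sD; rewrite mem_cat gD.
    by apply: EW => g gE; apply: sD; rewrite mem_cat gE orbT.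
  - by move=> P Q VW [D DV]; exists D => E /DV/VW.
have [|D DX] := (compact_near_coveringP X).1 cX (seq G) F (fun D x => U D x) FF.
  move=> x Xx; have [D xD] := locf x Xx.
  exists ([set y : config G A | {in D, x =1 y}], [set E : seq G | {subset D <= E}]).
    by split; [apply/nbhs_configP; exists D|exists D].
  move=> [y E] [/= xy DE] z t Xz Xt yz yt.
  rewrite -(xD z) -?(xD t) // => g gD; rewrite xy //; [exact/yt/DE|exact/yz/DE].
by exists D => x y Xx Xy xy; apply: (DX D _ x Xx).
Qed.

End Prodiscrete.

Lemma continuous_configP (G : groupType) (A B : finType) (X : set (config G A))
    (f : config G A -> config G B) :
  {within X, continuous f} <->
  forall x g, X x -> exists D : seq G, forall y, X y -> {in D, x =1 y} -> f x g = f y g.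
Proof.
rewrite subspace_continuousP; split=> cf x.
  move=> g Xx; have fxg : nbhs (f x) [set y : config G B | y g = f x g].
    by apply/nbhs_configP; exists [:: g] => y /= ->; rewrite ?inE.
  have [D DP] := (nbhs_configP x _).1 (cf x Xx _ fxg).
  by exists D => y Xy /DP /(_ Xy).
move=> Xx U /(nbhs_configP (f x))[E EU]; apply: (nbhs_configP x _).2.
have [D DP] : exists D : seq G, forall y, X y -> {in D, x =1 y} -> {in E, f x =1 f y}.
  elim: E {EU} => [|g E [D DP]]; first by exists [::].
  have [D' DP'] := cf x g Xx; exists (D' ++ D) => y Xy xy h.
  rewrite inE => /predU1P[->|hE].
    by apply: DP' => // k kD; apply: xy; rewrite mem_cat kD.
  by apply: DP => // k kD; apply: xy; rewrite mem_cat kD orbT.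
by exists D => y xy Xy; apply: EU; exact: DP.
Qed.

Section Subshifts.
Local Open Scope group_scope.
Variables (G : groupType) (A : finType).
Implicit Types (x y : config G A) (X : set (config G A)) (D : seq G).

Lemma shiftM g h x : shift g (shift h x) = shift (g * h) x.
Proof. by apply/funext => k; rewrite /shift invgM mulgA. Qed.

Lemma shift1 x : shift 1 x = x.
Proof. by apply/funext => k; rewrite /shift invg1 mul1g. Qed.

Lemma subshift_local (P : config G A -> Prop) D :
  (forall x y, {in D, x =1 y} -> P x -> P y) ->
  subshift [set x | forall g, P (shift g x)].
Proof.
move=> locP; split; last by move=> g x Px h; rewrite shiftM.
apply/closed_configP => x clx g.
have [y Py xy] := clx [seq g^-1 * h | h <- D].
apply: locP (Py g) => h hD; rewrite /shift xy //.
exact: map_f.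
Qed.

Lemma SFT_local (P : config G A -> Prop) D :
  (forall x y, {in D, x =1 y} -> P x -> P y) ->
  SFT [set x | forall g, P (shift g x)].
Proof.
move=> locP; split; first exact: subshift_local locP.
pose E := [fset g in D]%fset.
pose pat (q : {ffun E -> A}) : {fmap G -> A} := [fmap d : E => q d].
pose allowed q := `[< exists2 x, P x & forall d : E, x (val d) = q d >].
exists [fset pat q | q in {ffun E -> A} & ~~ allowed q]%fset.
apply/seteqP; split=> x Px g.
  move=> _ /imfsetP[q /= qN ->] cyl; case/asboolP: qN; exists (shift g x) => //.
  move=> d; have dE : val d \in domf (pat q) := valP d.
  have := cyl (val d) dE; rewrite in_fnd ffunE => -[<-].
  by congr (q _); exact: val_inj.
apply: contrapT => NP.
have /Px : pat [ffun d : E => shift g x (val d)] \in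
   [fset pat q | q in {ffun E -> A} & ~~ allowed q]%fset.
  apply/imfsetP; exists [ffun d : E => shift g x (val d)] => //=.
  apply/negP => /asboolP[y Py xy]; apply: NP; apply: locP Py => h hD.
  have hE : h \in E by rewrite inE.
  by have := xy (FSetSub hE); rewrite ffunE.
by move/(_ g); apply=> h hE; rewrite in_fnd !ffunE.
Qed.

Lemma sofic_SFT X : SFT X -> sofic X.
Proof.
move=> SX; split; first by case: SX.
exists A, X, id; split=> //; last by rewrite image_id.
by apply/continuous_configP => x g _; exists [:: g] => y _ -> //; rewrite inE.
Qed.

End Subshifts.

Lemma SFT_localP (G : groupType) (A : finType) (X : set (config G A)) : SFT X ->
  exists (D : seq G) (P : config G A -> Prop),
    (forall x y, {in D, x =1 y} -> P x -> P y) /\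
    X = [set x | forall g, P (shift g x)].
Proof.
move=> [_ [F ->]].
exists (flatten [seq (domf p : seq G) | p <- F]).
exists (fun x => forall p, p \in F -> ~ cylinder p x); split=> // x y xy Px p pF cy.
apply: (Px p pF) => h hp; rewrite cy // xy //.
by apply/(flatten_mapP (S := {fmap G -> A}) (s := enum_fset F)); exists p.
Qed.

(** * Words in groups *)

Section Words.
Local Open Scope group_scope.
Variables (T : finType) (G : groupType) (gen : T -> G).

Lemma eval_sword_nil : eval_sword gen [::] = 1.
Proof. by rewrite /eval_sword big_nil. Qed.

Lemma eval_sword_cons a w : eval_sword gen (a :: w) = eval_letter gen a * eval_sword gen w.
Proof. by rewrite /eval_sword big_cons. Qed.

Lemma eval_sword_cat v w : eval_sword gen (v ++ w) = eval_sword gen v * eval_sword gen w.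
Proof. by rewrite /eval_sword big_cat. Qed.

Lemma eval_sword_flatten (I : Type) (f : I -> sword T) (s : seq I) :
  eval_sword gen (flatten (map f s)) = \prod_(i <- s) eval_sword gen (f i).
Proof.
elim: s => [|i s IHs]; first by rewrite big_nil eval_sword_nil.
by rewrite big_cons -IHs -eval_sword_cat.
Qed.

Lemma eval_opp_letter a : eval_letter gen (opp_letter a) = (eval_letter gen a)^-1.
Proof. by case: a => t [] //=; rewrite /eval_letter /= invgK. Qed.

Definition inv_sword (w : sword T) : sword T := rev (map (@opp_letter T) w).

Lemma eval_inv_sword w : eval_sword gen (inv_sword w) = (eval_sword gen w)^-1.
Proof.
elim: w => [|a w IHw]; first by rewrite eval_sword_nil invg1.
rewrite /inv_sword /= rev_cons -cats1 eval_sword_cat IHw !eval_sword_cons.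
by rewrite eval_sword_nil mulg1 invgM eval_opp_letter.
Qed.

End Words.

(** * The subshift of lifted configurations *)

Section Lift.
Local Open Scope group_scope.
Variables (G H : groupType) (T : finType) (gen : T -> H).
Variables (rels : seq (sword T)) (word : H -> sword T) (J : {fset G}).
Hypothesis wordK : forall h, eval_sword gen (word h) = h.
Hypothesis relsP : forall w, eval_sword gen w = 1 <-> presented_eq rels w [::].

Notation lifted B := ({ffun T * bool -> J} * B)%type.

Section Walk.
Variable B : finType.
Implicit Types (x y : config G (lifted B)) (w : sword T) (z : config H B).

Definition walk x (g : G) w : G := foldl (fun k a => k * val ((x k).1 a)) g w.

Definition translate x (g : G) (h : H) : G := walk x g (word h).

Definition pull x (g : G) : config H B := fun h => (x (translate x g h)).2.

Definition valid_at x (g : G) : Prop :=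
  (forall a, walk x g [:: a; opp_letter a] = g) /\
  (forall r, r \in rels -> walk x g r = g).

Definition lift_subshift (Z : set (config H B)) : set (config G (lifted B)) :=
  [set x | forall g, valid_at x g /\ Z (pull x g)].

Lemma walk_cat x g v w : walk x g (v ++ w) = walk x (walk x g v) w.
Proof. by rewrite /walk foldl_cat. Qed.

Lemma walk_shift x k g w : walk (shift k x) g w = k * walk x (k^-1 * g) w.
Proof.
rewrite /walk; elim: w g => [|a w IHw] g /=; first by rewrite mulVKg.
by rewrite IHw /shift !mulgA.
Qed.

Lemma pull_shift x k g : pull (shift k x) g = pull x (k^-1 * g).
Proof. by apply/funext => h; rewrite /pull /translate walk_shift /shift mulKg. Qed.

Lemma valid_at_shift x k g : valid_at (shift k x) g <-> valid_at x (k^-1 * g).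
Proof.
have eqE w : (walk (shift k x) g w = g) <-> (walk x (k^-1 * g) w = k^-1 * g).
  by rewrite walk_shift; split=> [{2}<-|->]; rewrite ?mulKg ?mulVKg.
by split=> -[opp rel]; split=> [a|r rr]; apply/eqE; [exact: opp|exact: rel|exact: opp|exact: rel].
Qed.

Lemma walk_local x g w : exists D : seq G, forall y, {in D, x =1 y} ->
  walk x g w = walk y g w.
Proof.
elim: w g => [|a w IHw] g; first by exists [::].
have [D DP] := IHw (g * val ((x g).1 a)); exists (g :: D) => y xy /=.
rewrite /walk /= -(xy g) ?inE ?eqxx //; apply: DP => k kD.
by apply: xy; rewrite inE kD orbT.
Qed.

Lemma pull_local x g (E : seq H) : exists D : seq G, forall y, {in D, x =1 y} ->
  {in E, pull x g =1 pull y g}.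
Proof.
elim: E => [|h E [D DP]]; first by exists [::].
have [D' DP'] := walk_local x g (word h).
exists (translate x g h :: D' ++ D) => y xy k.
rewrite inE => /predU1P[->|kE].
  rewrite /pull (xy (translate x g h)) ?inE ?eqxx // /translate -DP' //.
  by move=> l lD; apply: xy; rewrite inE mem_cat lD orbT.
by apply: DP => // l lD; apply: xy; rewrite inE mem_cat lD !orbT.
Qed.

Lemma valid_at_local x g : exists D : seq G, forall y, {in D, x =1 y} ->
  valid_at x g = valid_at y g.
Proof.
have [D DP] : exists D : seq G, forall y, {in D, x =1 y} -> forall w,
    w \in [seq [:: a; opp_letter a] | a <- enum {: T * bool}] ++ rels ->
    walk x g w = walk y g w.
  elim: (_ ++ rels) => [|w s [D DP]]; first by exists [::].
  have [D' DP'] := walk_local x g w; exists (D' ++ D) => y xy v.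
  rewrite inE => /predU1P[->|vs].
    by apply: DP' => k kD; apply: xy; rewrite mem_cat kD.
  by apply: DP => // k kD; apply: xy; rewrite mem_cat kD orbT.
exists D => y /DP eqw; apply/propext.
have e1 a : walk x g [:: a; opp_letter a] = walk y g [:: a; opp_letter a].
  by apply: eqw; rewrite mem_cat map_f // mem_enum.
have e2 r : r \in rels -> walk x g r = walk y g r.
  by move=> rr; apply: eqw; rewrite mem_cat rr orbT.
split=> -[opp rel]; split=> [a|r rr].
- by rewrite -e1 opp.
- by rewrite -e2 // rel.
- by rewrite e1 opp.
- by rewrite e2 // rel.
Qed.

Section Valid.
Variable x : config G (lifted B).
Hypothesis vx : forall g, valid_at x g.

Lemma presented_eq_walk v w : presented_eq rels v w -> forall g, walk x g v = walk x g w.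
Proof.
elim=> {v w} [//|v w _ IH|u v w _ IH1 _ IH2|u v a|u v r rr] g.
- by rewrite IH.
- by rewrite IH1.
- by rewrite !walk_cat; congr walk; case: (vx (walk x g u)) => ->.
- by rewrite !walk_cat; congr walk; case: (vx (walk x g u)) => _ ->.
Qed.

Lemma walk_eval v w g : eval_sword gen v = eval_sword gen w -> walk x g v = walk x g w.
Proof.
move=> vw.
have inv u : walk x (walk x g w) (inv_sword w ++ u) = walk x g u.
  rewrite -walk_cat catA walk_cat.
  rewrite (@presented_eq_walk (w ++ inv_sword w) [::]) //.
  by apply/relsP; rewrite eval_sword_cat eval_inv_sword mulgV.
rewrite -inv.
rewrite (@presented_eq_walk _ [::]) //.
by apply/relsP; rewrite eval_sword_cat eval_inv_sword vw mulVg.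
Qed.

Lemma walkE g w : walk x g w = translate x g (eval_sword gen w).
Proof. by apply: walk_eval; rewrite wordK. Qed.

Lemma translateM g h k : translate x (translate x g h) k = translate x g (h * k).
Proof.
rewrite /translate -walk_cat; apply: walk_eval.
by rewrite eval_sword_cat !wordK.
Qed.

Lemma shift_pull h g : shift h (pull x g) = pull x (translate x g h^-1).
Proof. by apply/funext => k; rewrite /pull translateM. Qed.

End Valid.

Lemma lift_SFT (Z : set (config H B)) : SFT Z -> SFT (lift_subshift Z).
Proof.
move=> /SFT_localP[E [P [locP ->]]].
pose Q x := valid_at x 1 /\ P (pull x 1).
have -> : lift_subshift [set z | forall h, P (shift h z)] = [set x | forall g, Q (shift g x)].
  apply/seteqP; split=> x liftx g.
    have [vx Px] := liftx (g^-1); split.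
      by apply/valid_at_shift; rewrite mulg1.
    by rewrite pull_shift mulg1 -[pull _ _]shift1.
  have vx k : valid_at x k.
    by have [/valid_at_shift] := liftx k^-1; rewrite invgK mulg1.
  split=> // h; rewrite shift_pull //.
  have [_] := liftx (translate x g h^-1)^-1.
  by rewrite pull_shift invgK mulg1.
have [||D QD] := @uniform_window G (lifted B) Prop setT Q.
- exact: closedT.
- move=> x _; have [D DP] := valid_at_local x 1; have [D' DP'] := pull_local x 1 E.
  exists (D ++ D') => y _ xy; rewrite /Q (DP y); last first.
    by move=> g gD; apply: xy; rewrite mem_cat gD.
  have {DP'} xyE : {in E, pull x 1 =1 pull y 1}.
    by apply: DP' => g gD; apply: xy; rewrite mem_cat gD orbT.
  have yxE : {in E, pull y 1 =1 pull x 1} by move=> h /xyE.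
  by apply/propext; split=> -[vy Py]; split=> //; [exact: locP Py|exact: locP Py].
apply: (@SFT_local _ _ _ D) => x y xy Qx.
by rewrite -(QD x y).
Qed.

Section Copy.
Variables (act : G -> H -> G) (z : config H B) (c : G -> H).
Hypothesis ract : right_action act.
Hypothesis actJ : forall a g, g^-1 * act g (eval_letter gen a) \in J.
Hypothesis cM : forall g h, c (act g h) = c g * h.

Definition orbit_copy : config G (lifted B) :=
  fun g => ([ffun a => FSetSub (actJ a g)], z (c g)).

Lemma walk_copy g w : walk orbit_copy g w = act g (eval_sword gen w).
Proof.
have [act1 actM] := ract.
rewrite /walk; elim: w g => [|a w IHw] g /=; first by rewrite eval_sword_nil act1.
by rewrite IHw ffunE /= mulVKg eval_sword_cons actM.
Qed.

Lemma pull_copy g : pull orbit_copy g = shift (c g)^-1 z.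
Proof.
by apply/funext => h; rewrite /pull /translate walk_copy wordK /= cM /shift invgK.
Qed.

Lemma valid_at_copy g : valid_at orbit_copy g.
Proof.
have [act1 _] := ract; split=> [a|r rr]; rewrite walk_copy.
  by rewrite !eval_sword_cons eval_sword_nil mulg1 eval_opp_letter mulgV act1.
have -> : eval_sword gen r = 1.
  by apply/relsP; have := peq_rel [::] [::] rr; rewrite /= cats0.
exact: act1.
Qed.

Lemma lift_copy (Z : set (config H B)) :
  (forall h z, Z z -> Z (shift h z)) -> Z z -> lift_subshift Z orbit_copy.
Proof.
move=> ZM Zz g; split; first exact: valid_at_copy.
by rewrite pull_copy; exact: ZM.
Qed.

End Copy.

End Walk.

Section LiftMap.
Variables (B C : finType) (Z : set (config H B)) (f : config H B -> config H C).
Hypothesis cf : {within Z, continuous f}.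
Hypothesis fM : forall h z, Z z -> f (shift h z) = shift h (f z).

Definition lift_map (x : config G (lifted B)) : config G (lifted C) :=
  fun g => ((x g).1, f (pull x g) 1).

Lemma walk_lift_map x g w : walk (lift_map x) g w = walk x g w.
Proof. by rewrite /walk; elim: w g => //= a w IHw g. Qed.

Lemma pull_lift_map x g : lift_subshift Z x -> pull (lift_map x) g = f (pull x g).
Proof.
move=> liftx; have vx k : valid_at x k by case: (liftx k).
apply/funext => h; rewrite /pull /translate walk_lift_map /= -/(translate x g h).
rewrite -[h in LHS]invgK -shift_pull // fM; last by case: (liftx g).
by rewrite /shift invgK mulg1.
Qed.

Lemma lift_lift_map x : lift_subshift Z x -> lift_subshift (f @` Z) (lift_map x).
Proof.
move=> liftx g; have [[opp rel] Zx] := liftx g; split.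
  by split=> [a|r /rel]; rewrite walk_lift_map.
by rewrite pull_lift_map //; exists (pull x g).
Qed.

Lemma lift_map_shift g x : lift_map (shift g x) = shift g (lift_map x).
Proof. by apply/funext => k; rewrite /lift_map pull_shift. Qed.

Lemma continuous_lift_map : {within lift_subshift Z, continuous lift_map}.
Proof.
apply/continuous_configP => x g liftx; have [_ Zx] := liftx g.
have [E EP] := (continuous_configP Z f).1 cf (pull x g) 1 Zx.
have [D DP] := pull_local x g E; exists (g :: D) => y lifty xy.
rewrite /lift_map -(xy g) ?inE ?eqxx //; congr pair; apply: EP.
  by case: (lifty g).
by apply: DP => k kD; apply: xy; rewrite inE kD orbT.
Qed.

Lemma lift_map_copy (act : G -> H -> G) (c : G -> H)
    (actJ : forall a g, g^-1 * act g (eval_letter gen a) \in J) z :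
  right_action act -> (forall g h, c (act g h) = c g * h) ->
  Z z -> lift_map (orbit_copy z c actJ) = orbit_copy (f z) c actJ.
Proof.
move=> ract cM Zz; apply/funext => g; rewrite /lift_map pull_copy // fM //.
by rewrite /shift invgK mulg1.
Qed.

End LiftMap.

End Lift.

Lemma closed_image_config (G : groupType) (A B : finType) (X : set (config G A))
    (f : config G A -> config G B) :
  closed X -> {within X, continuous f} -> closed (f @` X).
Proof.
move=> clX cf; apply: compact_closed.
  by apply: (@hausdorff_product G (fun=> discrete_topology B)) => _; exact: discrete_hausdorff.
apply: continuous_compact => //.
exact: subclosed_compact clX (@compact_config G A) _.
Qed.

Lemma sofic_image (G : groupType) (A B : finType) (X : set (config G A))
    (f : config G A -> config G B) :
  SFT X -> {within X, continuous f} ->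
  (forall g x, X x -> f (shift g x) = shift g (f x)) -> sofic (f @` X).
Proof.
move=> sftX cf fM; have [[clX XM] _] := sftX; split; last by exists A, X, f.
split; first exact: closed_image_config.
by move=> g _ [x Xx <-]; exists (shift g x); [exact: XM|exact: fM].
Qed.

Section TranslationLike.
Local Open Scope group_scope.
Variables (G H : groupType) (S : {fset H}) (act : G -> H -> G).
Hypothesis genS : generates S.
Hypothesis tact : translation_like S act.

Lemma translation_like_inj g : injective (act g).
Proof.
have [[act1 actM] free _] := tact => h k ghk.
have kh1 : k^-1 * h = 1 by apply: (free (act g k)); rewrite -actM mulVKg.
by rewrite -[h](mulVKg k) kh1 mulg1.
Qed.

Lemma finite_displacement h : finite_set [set g^-1 * act g h | g in [set: G]].
Proof.
have [[act1 actM] _ bnd] := tact.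
have [w <-] := genS h; elim: w => [|[s b] w IHw].
  apply: sub_finite_set (finite_set1 1) => _ [g _ <-].
  by rewrite eval_sword_nil act1 mulVg.
rewrite eval_sword_cons; set D := [set _ | _ in _] in IHw.
have fins : finite_set [set g^-1 * act g (eval_letter val (s, b)) | g in [set: G]].
  have bnds := bnd _ (valP s); case: b => //; rewrite /eval_letter /=.
  apply: sub_finite_set (finite_image (fun g => g^-1) bnds) => _ [g _ <-].
  exists ((act g (val s)^-1)^-1 * g); last by rewrite invgM invgK.
  by exists (act g (val s)^-1) => //; rewrite -actM mulVg act1.
apply: sub_finite_set (finite_image2 (fun u v => u * v) fins IHw) => _ [g _ <-].
exists (g^-1 * act g (eval_letter val (s, b))); first by exists g.
set k := act g _; exists (k^-1 * act k (eval_sword val w)); first by exists k.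
by rewrite /k actM -mulgA mulVKg.
Qed.

Lemma displacement_fset (I : finType) (f : I -> H) :
  exists2 J : {fset G}, 1 \in J & forall i g, g^-1 * act g (f i) \in J.
Proof.
have /choice[D DP] : forall i, exists D : {fset G}, forall g, g^-1 * act g (f i) \in D.
  move=> i; have /finite_fsetP[D DE] := finite_displacement (f i).
  exists D => g; have : [set g^-1 * act g (f i) | g in [set: G]] (g^-1 * act g (f i)).
    by exists g.
  by rewrite DE.
exists [fset g in 1 :: flatten [seq enum_fset (D i) | i <- enum I]]%fset.
  by rewrite !inE eqxx.
move=> i g; rewrite !inE; apply/orP; right.
by apply/flatten_mapP; exists i; [rewrite mem_enum|exact: DP].
Qed.

Lemma exists_cocycle (rep : G -> G) :
  (forall g, exists h, act (rep g) h = g) -> (forall g h, rep (act g h) = rep g) ->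
  exists2 c : G -> H, (forall g, act (rep g) (c g) = g) &
    forall g h, c (act g h) = c g * h.
Proof.
have [[act1 actM] _ _] := tact => /choice[c cP] repM; exists c => // g h.
by apply: (@translation_like_inj (rep g)); rewrite actM cP -{1}(repM g h) cP.
Qed.

Lemma exists_orbit_representative :
  exists rep : G -> G, (forall g, exists h, act (rep g) h = g) /\
    forall g h, rep (act g h) = rep g.
Proof.
have [[act1 actM] _ _] := tact.
pose orbit g := [set k | exists h, act k h = g].
exists (fun g => xget 1 (orbit g)); split=> [g|g h].
  by apply: (@xgetPex _ 1 (orbit g)); exists g, 1.
congr xget; apply/seteqP; split=> k [h' kh].
  by exists (h' * h^-1); rewrite actM kh -actM mulgV act1.
by exists (h' * h); rewrite actM kh.
Qed.

End TranslationLike.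

(** * Computing in a finitely generated group *)

Lemma word_code_inj (T : finType) : injective (@word_code T).
Proof.
move=> u v /(can_inj CodeSeq.codeK); apply: inj_map.
by move=> a b /ord_inj/enum_rank_inj.
Qed.

Lemma computable_cat (T : finType) k (u v : env k -> seq T) :
  computable (fun e => word_code (u e)) -> computable (fun e => word_code (v e)) ->
  computable (fun e => word_code (u e ++ v e)).
Proof.
move=> cu cv; have := computable_prepend (fun a => [:: a]) cv (computable_rev cu).
apply: eq_computable => e; rewrite prependE revK; congr (word_code (_ ++ _)).
by elim: (u e) => //= a w ->.
Qed.

Section Reduction.
Variable T : finType.
Implicit Types (a : T * bool) (w : sword T).

Definition push_letter a w : sword T :=
  if w is b :: w' then if b == opp_letter a then w' else a :: w else [:: a].

Definition reduce w : sword T := foldr push_letter [::] w.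

Lemma reduced_reduce w : reduced (reduce w).
Proof.
elim: w => //= a w; case: (reduce w) => //= b u; case: ifP => [_|/negbT nb] red.
  exact: path_sorted red.
by rewrite /reduced /= nb.
Qed.

Lemma eval_reduce (G : groupType) (gen : T -> G) w :
  eval_sword gen (reduce w) = eval_sword gen w.
Proof.
elim: w => //= a w IHw; rewrite eval_sword_cons -IHw.
case: (reduce w) => [|b u] /=; first by rewrite eval_sword_cons.
case: eqP => [->|_]; last by rewrite eval_sword_cons.
by rewrite eval_sword_cons eval_opp_letter mulVKg.
Qed.

Lemma computable_reduce k (w : env k -> sword T) :
  computable (fun e => word_code (w e)) -> computable (fun e => word_code (reduce (w e))).
Proof.
move=> cw.
have := @computable_word_foldl _ _ (@word_code _) k (fun e => rev (w e)) (fun=> [::])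
  (fun _ u a => push_letter a u) (computable_rev cw) (computable_const _ _).
move=> H; apply: (eq_computable _ (H _)) => [e|a]; first by rewrite foldl_rev.
exists (fun _ n => if (n != 0) && (head 0 (CodeSeq.decode n) == rank (opp_letter a))
  then CodeSeq.code (behead (CodeSeq.decode n))
  else CodeSeq.code (rank a :: CodeSeq.decode n)); split.
  have cv : computable (fun e : env k.+1 => e.2) by exact: computable_var.
  apply: (@computable_if _ (fun e : env k.+1 => (e.2 != 0) && _)).
  - apply: (@computable_and _ (fun e : env k.+1 => e.2 != 0)).
      by apply: computable_neg; exact: computable_eq0.
    apply: computable_eq; last exact: computable_const.
    exact: computable_decode_head.
  - exact: computable_decode_behead.
  - by apply: computable_code_cons => //; exact: computable_const.
move=> _ [|b u]; first by rewrite decode_word_code.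
rewrite decode_word_code [word_code (b :: u) == 0]code_eq0 /=.
rewrite (inj_eq (@ord_inj _)) (inj_eq enum_rank_inj).
by case: ifP.
Qed.

End Reduction.

Section FreeGroupIndex.
Local Open Scope group_scope.
Variables (G : groupType) (R : {fset G}) (nu : nat -> free_group R).
Hypotheses (genR : generates R) (cnu : computable_bijection nu).

Lemma computable_nu k (n : env k -> nat) :
  computable n -> computable (fun e => word_code (val (nu (n e)))).
Proof. by case: cnu => _; exact: computable1P. Qed.

Lemma exists_index : exists idx : sword R -> nat,
  (forall w, epi (nu (idx w)) = eval_sword val w) /\
  forall k (w : env k -> sword R), computable (fun e => word_code (w e)) ->
    computable (fun e => idx (w e)).
Proof.
have [[inv nuK invK] _] := cnu.
pose idx w := inv (exist _ (reduce w) (reduced_reduce w) : free_group R).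
have idxE w : val (nu (idx w)) = reduce w by rewrite /idx invK.
exists idx; split=> [w|k w cw]; first by rewrite /epi idxE eval_reduce.
apply: (@computable_mu _ _ (fun e n =>
    (word_code (val (nu n)) != word_code (reduce (w e))) : nat)).
- apply: computable_neg; apply: computable_eq.
    by apply: computable_nu; exact: computable_var.
  exact/computable_reduce/(computable_wk cw).
- by move=> e; rewrite idxE eqxx.
- move=> e i lti; rewrite eqb0 negbK; apply/eqP => /word_code_inj eqw.
  have : nu i = nu (idx (w e)) by apply: val_inj; rewrite idxE.
  by move/(can_inj nuK) => ii; rewrite ii ltnn in lti.
Qed.

Lemma epi_surj g : exists n, epi (nu n) = g.
Proof. by have [idx [idxE _]] := exists_index; have [w <-] := genR g; exists (idx w). Qed.

Lemma exists_right_mul : exists mul : G -> nat -> nat,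
  (forall g n, epi (nu (mul g n)) = epi (nu n) * g) /\
  forall g k (n : env k -> nat), computable n -> computable (fun e => mul g (n e)).
Proof.
have [idx [idxE cidx]] := exists_index; have [word wordE] := choice genR.
exists (fun g n => idx (val (nu n) ++ word g)); split=> [g n|g k n cn].
  by rewrite idxE eval_sword_cat wordE.
apply: cidx; apply: computable_cat; first exact: computable_nu.
exact: computable_const.
Qed.

End FreeGroupIndex.

Section Symbols.
Variables (A : finType) (a0 : A).

Definition symbol (x : nat -> bool) (i : nat) : A :=
  head a0 [seq a <- enum A | x (i * #|A| + rank a)].

Lemma symbol_bits (T : finType) (nu : nat -> free_group T) (y : free_group T -> A) i :
  symbol (bits nu y) i = y (nu i).
Proof.
rewrite /symbol (@eq_filter _ _ (pred1 (y (nu i)))) ?filter_pred1_uniq ?enum_uniq ?mem_enum //.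
move=> a; rewrite /bits divnMDl ?modnMDl; last by apply/card_gt0P; exists a.
rewrite divn_small ?ltn_ord // modn_small ?ltn_ord // addn0 /= eq_sym.
by rewrite (inj_eq (@ord_inj _)) (inj_eq enum_rank_inj).
Qed.

Lemma computable_symbol k (n : env k -> nat) :
  computable n -> computable (fun e => rank (symbol (oracle e) (n e))).
Proof.
move=> cn; rewrite /symbol; elim: (enum A) => [|a s IHs]; first exact: (computable_const k (rank a0)).
apply: (@eq_computable _ (fun e => if oracle e (n e * #|A| + rank a) then rank a else
    rank (head a0 [seq a <- s | oracle e (n e * #|A| + rank a)]))).
  by move=> e /=; case: ifP.
apply: (@computable_if _ (fun e => oracle e (n e * #|A| + rank a))) => //.
  apply: computable_oracle; apply: computable_add; last exact: computable_const.
  by apply: computable_mul => //; exact: computable_const.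
exact: computable_const.
Qed.

End Symbols.

Lemma medvedev_le_bits (G : groupType) (R : {fset G}) (nu : nat -> free_group R)
    (A : finType) (P : set (config G A)) (Q : set (nat -> bool))
    (F : (nat -> bool) -> nat -> A) :
  computable (fun e : env 1 => rank (F e.1 e.2)) ->
  (forall x, Q x -> exists2 y, P y & forall i, F x i = y (epi (nu i))) ->
  medvedev_le (bits nu @` pullback (R := R) P) Q.
Proof.
move=> cF FP.
have [p pP] : computable (fun e : env 1 =>
    (rank (F e.1 (e.2 %/ #|A|)) == e.2 %% #|A|) : nat).
  have cv : computable (fun e : env 1 => e.2) by exact: computable_var.
  have cA : computable (fun e : env 1 => #|A|) by exact: computable_const.
  apply: computable_eq; last exact: computable_modn.
  apply: (@computable_subst 1 1 (fun e => (e.1, e.2 %/ #|A|))) cF => // -[|i] /=.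
    exact: computable_divn.
  exact: (computable_arg 1 i.+1).
exists p => x /FP[y Py Fy]; exists (bits nu (y \o @epi G R)).
  by exists (y \o @epi G R) => //; exists y.
by move=> n; have := pP (x, n); rewrite /= Fy.
Qed.

Lemma medvedev_le_set0 (P : set (nat -> bool)) : medvedev_le P set0.
Proof. by exists PZero. Qed.

Lemma medvedev_le_subset (P Q : set (nat -> bool)) : Q `<=` P -> medvedev_le P Q.
Proof. by move=> QP; exists POracle => x /QP Px; exists x => // n; constructor. Qed.

Section BlockMap.
Local Open Scope group_scope.
Variables (G : groupType) (R : {fset G}) (nu : nat -> free_group R).
Hypotheses (genR : generates R) (cnu : computable_bijection nu).
Variables (A B : finType) (X : set (config G A)) (f : config G A -> config G B).
Hypotheses (subX : subshift X) (cf : {within X, continuous f}).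
Hypothesis fM : forall g x, X x -> f (shift g x) = shift g (f x).

Lemma medvedev_le_image :
  medvedev_le (bits nu @` pullback (R := R) (f @` X)) (bits nu @` pullback (R := R) X).
Proof.
have [->|/set0P[x0 Xx0]] := eqVneq X set0.
  rewrite [X in medvedev_le _ X](_ : _ = set0); first exact: medvedev_le_set0.
  by apply/seteqP; split=> // x [y [z []]].
have [clX XM] := subX.
have [x Xx|D DP] := @uniform_window G A B X (fun x => f x 1) clX.
  exact: (continuous_configP X f).1 cf x 1 Xx.
have [mul [mulE cmul]] := exists_right_mul genR cnu.
pose local_rule (l : seq A) : B :=
  f (xget x0 [set x : config G A | X x /\ map x D = l]) 1.
have ruleP x : X x -> local_rule (map x D) = f x 1.
  move=> Xx; have [Xy yx] := @xgetPex _ x0 [set y : config G A | X y /\ map y D = map x D]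
    (ex_intro _ x (conj Xx erefl)).
  by apply: DP => // g gD; apply/eq_in_map: g gD.
apply: (medvedev_le_bits (F := fun x i =>
    local_rule [seq symbol (x0 1) x (mul g i) | g <- D])).
  apply: (computable_map (f := fun g (e : env 1) => symbol (x0 1) e.1 (mul g e.2))
    D (fun l => rank (local_rule l))) => g.
  by apply: computable_symbol; apply: cmul; exact: computable_var.
move=> _ [_ [x Xx <-] <-]; exists (f x); first by exists x.
move=> i; rewrite -[epi (nu i)]mulg1 -[in RHS](invgK (epi (nu i))).
rewrite -[RHS]/(shift (epi (nu i))^-1 (f x) 1) -fM // -ruleP; last exact: XM.
congr local_rule; apply: eq_map => g.
by rewrite symbol_bits /= mulE /shift invgK.
Qed.

End BlockMap.

(** * Comparing a subshift with its lift *)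

Section Reductions.
Local Open Scope group_scope.
Variables (G H : groupType) (R : {fset G}) (S : {fset H}).
Variables (nuG : nat -> free_group R) (nuH : nat -> free_group S).
Hypotheses (genR : generates R) (genS : generates S).
Hypotheses (cnuG : computable_bijection nuG) (cnuH : computable_bijection nuH).
Variables (T : finType) (gen : T -> H) (rels : seq (sword T)) (word : H -> sword T).
Variable J : {fset G}.
Hypothesis wordK : forall h, eval_sword gen (word h) = h.
Hypothesis relsP : forall w, eval_sword gen w = 1 <-> presented_eq rels w [::].
Variable B : finType.

Notation lifted := ({ffun T * bool -> J} * B)%type.

(* Following the arrows of a lifted configuration from the identity of [G]
   computes its pull-back at the identity. *)
Lemma medvedev_le_lift (Z : set (config H B)) :
  medvedev_le (bits nuH @` pullback (R := S) Z)
    (bits nuG @` pullback (R := R) (lift_subshift rels word (J := J) Z)).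
Proof.
set L := lift_subshift _ _ _; have [L0|/set0P[x0 Lx0]] := eqVneq L set0.
  rewrite L0 [X in medvedev_le _ X](_ : _ = set0); first exact: medvedev_le_set0.
  by apply/seteqP; split=> // x [y [z []]].
have [idx [idxE _]] := exists_index cnuG.
have [mul [mulE cmul]] := exists_right_mul genR cnuG.
pose letter_word (b : S * bool) : sword T := word (eval_letter val b).
pose sym : (nat -> bool) -> nat -> lifted := symbol (x0 1).
pose step x n a := mul (val ((sym x n).1 a)) n.
pose walk_index x i :=
  foldl (step x) (idx [::]) (flatten (map letter_word (val (nuH i)))).
apply: (medvedev_le_bits (F := fun x i => (sym x (walk_index x i)).2)).
  apply: (computable_fin (fun s : lifted => rank s.2)
    (f := fun e : env 1 => sym e.1 (walk_index e.1 e.2))).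
  apply: (@computable_symbol lifted (x0 1) 1 (fun e => walk_index e.1 e.2)).
  apply: (@computable_word_foldl (T * bool)%type nat id 1
    (fun e => flatten (map letter_word (val (nuH e.2)))) (fun=> idx [::])
    (fun e => step e.1)).
  - apply: computable_flatmap; apply: computable_nu => //.
    exact: computable_var.
  - exact: computable_const.
  - move=> a; exists (fun e n => step e.1 n a); split=> //.
    apply: (computable_case (f := fun e : env 2 => sym (oracle e) e.2)
      (g := fun s e => mul (val (s.1 a)) e.2)).
      by apply: computable_symbol; exact: computable_var.
    by move=> s; apply: cmul; exact: computable_var.
move=> x1 [y1 [x Lx yE] xE]; subst y1 x1.
have vx g : valid_at rels x g by case: (Lx g).
exists (pull word x 1); first by case: (Lx 1).
move=> i; rewrite /sym symbol_bits /=.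
have stepE w n : epi (nuG (foldl (step (bits nuG (x \o @epi G R))) n w)) =
    walk x (epi (nuG n)) w.
  elim: w n => //= a w IHw n; rewrite IHw /step mulE /sym symbol_bits //.
rewrite /walk_index stepE idxE eval_sword_nil /pull.
congr (x _).2; rewrite (walkE wordK relsP) //; congr translate.
rewrite eval_sword_flatten /epi /eval_sword.
by apply: eq_bigr => b _; exact: wordK.
Qed.

Variables (act : G -> H -> G) (c : G -> H).
Hypothesis actJ : forall a g, g^-1 * act g (eval_letter gen a) \in J.
Hypothesis J1 : 1 \in J.

Lemma medvedev_le_copy (Y : set (config H B)) (X : set (config G lifted))
    (h : env 1 -> nat) :
  (forall a, computable (fun e : env 1 => rank (FSetSub (actJ a (epi (nuG e.2)))))) ->
  computable h -> (forall e, epi (nuH (h e)) = c (epi (nuG e.2))) ->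
  (forall y, Y y -> X (orbit_copy y c actJ)) ->
  medvedev_le (bits nuG @` pullback (R := R) X) (bits nuH @` pullback (R := S) Y).
Proof.
move=> ctau ch hE copyX.
have [->|/set0P[y0 Yy0]] := eqVneq Y set0.
  rewrite [X in medvedev_le _ X](_ : _ = set0); first exact: medvedev_le_set0.
  by apply/seteqP; split=> // x [y [z []]].
pose arrows (l : seq J) : {ffun T * bool -> J} :=
  [ffun a => nth (FSetSub J1) l (index a (enum {: T * bool}))].
have arrowsE i : arrows [seq FSetSub (actJ a (epi (nuG i))) | a <- enum {: T * bool}] =
    [ffun a => FSetSub (actJ a (epi (nuG i)))].
  apply/ffunP => a; rewrite !ffunE (nth_map a) ?nth_index ?mem_enum //.
  by rewrite index_mem mem_enum.
pose F (x : nat -> bool) i : lifted :=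
  ([ffun a => FSetSub (actJ a (epi (nuG i)))], symbol (y0 1) x (h (x, i))).
apply: (medvedev_le_bits (F := F)).
  apply: (@computable_case B 1 (fun e => symbol (y0 1) (oracle e) (h (e.1, e.2)))
    (fun b e => rank (([ffun a => FSetSub (actJ a (epi (nuG e.2)))], b) : lifted))).
    by apply: computable_symbol; apply: eq_computable ch => -[].
  move=> b; have := computable_map (enum {: T * bool})
    (fun l => rank ((arrows l, b) : lifted)) ctau.
  by apply: eq_computable => e; rewrite arrowsE.
move=> x1 [y1 [y Yy yE] xE]; subst y1 x1; exists (orbit_copy y c actJ); first exact: copyX.
by move=> i; rewrite /F symbol_bits /= hE.
Qed.

End Reductions.

(** * Computable translation-like actions *)

Lemma computable_finite_re (T : finType) k (f : env k -> T)
    (b : T -> env k -> nat -> bool) :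
  (forall t, computable (fun e : env k.+1 => b t e.1 e.2 : nat)) ->
  (forall t e, (exists s, b t e s) <-> f e = t) ->
  computable (fun e => rank (f e)).
Proof.
move=> cb bP; pose C e n s := switch n (fun t : T => b t e s : nat) != 0.
have [||h ch hP] := @computable_search k C.
- apply/computable_neg/computable_eq0.
  apply: (@computable_switch T k.+2 (fun e => e.1.2) (fun t e => b t e.1.1 e.2)).
    exact: computable_var1.
  move=> t; apply: (@computable_subst k.+1 k.+2 (fun e => (e.1.1, e.2))) (cb t) => //.
  by case=> [|i]; [exact: computable_var|exact: (computable_arg k.+2 i.+2)].
- move=> e; have [s bs] := (bP (f e) e).2 erefl; exists (rank (f e)), s.
  by rewrite /C switch_rank bs.
apply: eq_computable ch => e; have [s] := hP e; rewrite /C /switch.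
case: pickP => // t /eqP <-; rewrite eqb0 negbK => bs.
by congr (rank _); apply/esym/bP; exists s.
Qed.

Section PositiveWords.
Local Open Scope group_scope.
Variables (G : groupType) (R : {fset G}).
Hypothesis symR : symmetric_set R.

Definition positive_letter (a : R * bool) : R :=
  if a.2 then FSetSub (symR (valP a.1)) else a.1.

Definition positive_word (w : sword R) : seq R :=
  flatten [seq [:: positive_letter a] | a <- w].

Lemma eval_positive_word w : eval_word (positive_word w) = eval_sword val w.
Proof.
rewrite /eval_word /positive_word /eval_sword.
elim: w => [|[r b] w IHw]; first by rewrite !big_nil.
by rewrite /= !big_cons IHw; case: b.
Qed.

Lemma computable_positive_word k (w : env k -> sword R) :
  computable (fun e => word_code (w e)) ->
  computable (fun e => word_code (positive_word (w e))).
Proof. exact: computable_flatmap. Qed.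

End PositiveWords.

Section ComputableAction.
Local Open Scope group_scope.
Variables (G H : groupType) (R : {fset G}) (S : {fset H}).
Variables (nuG : nat -> free_group R) (nuH : nat -> free_group S).
Hypotheses (genR : generates R) (genS : generates S).
Hypotheses (symR : symmetric_set R) (symS : symmetric_set S).
Hypotheses (cnuG : computable_bijection nuG) (cnuH : computable_bijection nuH).
Hypothesis recG : recursively_presented G.

(* The recursive presentation may use another generating set [R'], so words are
   first rewritten over it. *)
Lemma semidecidable_eq k (n : env k -> nat) (v : env k -> seq R) :
  computable n -> computable (fun e => word_code (v e)) ->
  exists2 b : env k -> nat -> bool,
    computable (fun e : env k.+1 => b e.1 e.2 : nat) &
    forall e, (exists t, b e t) <-> epi (nuG (n e)) = eval_word (v e).
Proof.
move=> cn cv; have [R' genR' /re_wordsP[b cb bP]] := recG.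
have [tr trE] := choice genR'.
pose inv_letter (a : R * bool) := tr (eval_letter val (opp_letter a)).
pose W e := prepend inv_letter (flatten [seq tr (val r) | r <- v e]) (val (nuG (n e))).
have cW : computable (fun e => word_code (W e)).
  apply: computable_prepend; last exact: computable_nu.
  exact: computable_flatmap.
have WE e : eval_sword val (W e) = (epi (nuG (n e)))^-1 * eval_word (v e).
  rewrite /W prependE eval_sword_cat eval_sword_flatten; congr (_ * _).
    rewrite /epi; elim: (val _) => [|a w IHw].
      by rewrite big_nil eval_sword_nil invg1.
    rewrite rev_cons -cats1 big_cat big_seq1 /= IHw eval_sword_cons invgM.
    by rewrite /inv_letter trE eval_opp_letter.
  by rewrite eval_sword_flatten; apply: eq_bigr => r _; rewrite trE.
exists (fun e t => b (word_code (W e)) t).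
  apply: (@computable_subst 2 k.+1 (fun e => (oracle e, word_code (W e.1), e.2)))
    cb => // -[|[|i]] /=.
  - exact: computable_var.
  - exact: (computable_wk cW).
  - by apply: (eq_computable _ (computable_const _ 0)) => e; rewrite nth_nil.
move=> e; rewrite -bP WE; split=> [uv1|<-]; last by rewrite mulVg.
by rewrite -[RHS](mulVKg (epi (nuG (n e)))) uv1 mulg1.
Qed.

Variable act : G -> H -> G.
Hypothesis tact : translation_like S act.
Hypothesis cact : computable_action R S act.
Hypothesis dact : decidable_orbit_membership R act.

Lemma computable_displacement (J : {fset G}) (d : H)
    (dJ : forall g, g^-1 * act g d \in J) :
  computable (fun e : env 1 => rank (FSetSub (dJ (epi (nuG e.2))))).
Proof.
have [mul [mulE cmul]] := exists_right_mul genR cnuG.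
have [f cf fE] := cact; have [w wE] := genS d.
pose v (e : env 1) := f (positive_word symR (val (nuG e.2))) (positive_word symS w).
have cvar : computable (fun e : env 1 => e.2) by exact: computable_var.
have cv : computable (fun e => word_code (v e)).
  apply: computable_words2P => //.
    by apply: computable_positive_word; exact: computable_nu.
  exact: (computable_const 1 (word_code _)).
have /choice[b bP] : forall j : J, exists b : env 1 -> nat -> bool,
    computable (fun e : env 2 => b e.1 e.2 : nat) /\
    forall e, (exists t, b e t) <-> epi (nuG (mul (val j) e.2)) = eval_word (v e).
  move=> j; have [b cb bP] := semidecidable_eq (cmul (val j) _ _ cvar) cv.
  by exists b; split.
apply: (@computable_finite_re J 1 _ b) => [j|j e]; first by have [] := bP j.
have [_ ->] := bP j; rewrite mulE fE !eval_positive_word wE -/(epi _).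
split=> [eqj|<-]; last by rewrite mulVKg.
by apply: val_inj; rewrite /= -eqj mulKg.
Qed.

Lemma computable_cocycle : exists c : G -> H,
  (forall g h, c (act g h) = c g * h) /\ exists2 h : env 1 -> nat, computable h &
    forall e, epi (nuH (h e)) = c (epi (nuG e.2)).
Proof.
have [[act1 actM] free _] := tact; have [f cf fE] := cact.
have exn g : exists n, `[< exists h, g = act (epi (nuG n)) h >].
  by have [n ng] := epi_surj genR cnuG g; exists n; apply/asboolP; exists 1; rewrite act1.
pose r g := ex_minn (exn g).
have rM g h : r (act g h) = r g.
  have le g1 h1 : r (act g1 h1) <= r g1.
    rewrite /r; case: ex_minnP => m _ min; case: ex_minnP => n /asboolP[h' g1E] _.
    by apply: min; apply/asboolP; exists (h' * h1); rewrite actM -g1E.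
  apply/eqP; rewrite eqn_leq le /=.
  by have := le (act g h) h^-1; rewrite -actM mulgV act1.
have repE g : exists h, act (epi (nuG (r g))) h = g.
  by rewrite /r; case: ex_minnP => n /asboolP[h ->] _; exists h.
have [|c cE cM] := exists_cocycle tact repE; first by move=> g h; rewrite rM.
exists c; split=> //.
have cpos k (n : env k -> nat) : computable n ->
    computable (fun e => word_code (positive_word symR (val (nuG (n e))))).
  by move=> cn; apply: computable_positive_word; exact: computable_nu.
have cr : computable (fun e : env 1 => r (epi (nuG e.2))).
  apply: (@computable_mu 1 (fun e => r (epi (nuG e.2))) (fun e n =>
      nat_of_bool (~~ `[< exists h, epi (nuG e.2) = act (epi (nuG n)) h >]))).
  - apply: computable_neg.
    have := computable_decidable_words2 dact
      (cpos 2 _ (computable_var 1)) (cpos 2 _ (computable_var1 0)).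
    by apply: eq_computable => e; rewrite !eval_positive_word.
  - by move=> e; rewrite /r; case: ex_minnP => n ->.
  - move=> e i; rewrite /r; case: ex_minnP => m _ min lt; rewrite eqb0 negbK.
    by apply/negP => /min; rewrite leqNgt lt.
pose v (e : env 2) := f (positive_word symR (val (nuG (r (epi (nuG e.1.2))))))
  (positive_word symS (val (nuH e.2))).
have cv : computable (fun e => word_code (v e)).
  apply: computable_words2P => //.
    exact: (cpos 2 _ (computable_wk cr)).
  by apply: computable_positive_word; apply: computable_nu => //; exact: computable_var.
have [b cb bP] := semidecidable_eq (computable_var1 0) cv.
have [||h ch hP] := @computable_search 1 (fun e n s => b (e, n) s).
- by apply: eq_computable cb => -[[]].
- move=> e; have [n nE] := epi_surj genS cnuH (c (epi (nuG e.2))); exists n.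
  by apply/bP; rewrite fE !eval_positive_word -!/(epi _) nE cE.
exists h => // e; have /bP := hP e; rewrite fE !eval_positive_word -!/(epi _) /=.
by move=> eqg; apply: (translation_like_inj tact (g := epi (nuG (r (epi (nuG e.2)))))); rewrite cE.
Qed.

End ComputableAction.

Lemma degree_le_zero d : degree_le d zero_degree -> d = zero_degree.
Proof.
case=> P [Q [-> /esym/degree_of_eq0[x Qx [q qx]] [p pP]]]; apply/degree_of_eq0.
have [y Py xy] := pP x Qx; exists y => //; exists (subst_oracle q p) => n.
exact: runs_subst_oracle (xy n).
Qed.

Theorem corollary4p15
    (G H : groupType) (R : {fset G}) (S : {fset H})
    (nuG : nat -> free_group R) (nuH : nat -> free_group S) :
  generates R -> symmetric_set R ->
  generates S -> symmetric_set S ->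
  computable_bijection nuG -> computable_bijection nuH ->
  finitely_presented H ->
  (exists act : G -> H -> G, translation_like S act) ->
  ((forall (B : finType) (Y : set (config H B)), sofic Y -> Y !=set0 ->
      exists (A : finType) (X : set (config G A)),
        [/\ SFT X, X !=set0 &
            degree_le (subshift_degree nuH Y) (subshift_degree nuG X)])
   /\
   ((exists (B : finType) (Y : set (config H B)),
       [/\ sofic Y, Y !=set0 & subshift_degree nuH Y <> zero_degree]) ->
    exists (A : finType) (X : set (config G A)),
      [/\ sofic X, X !=set0 & subshift_degree nuG X <> zero_degree]))
  /\
  (recursively_presented G ->
   (exists act : G -> H -> G,
      [/\ translation_like S act, computable_action R S act
        & decidable_orbit_membership R act]) ->
   degrees_SFT nuH `<=` degrees_SFT nuG /\
   degrees_sofic nuH `<=` degrees_sofic nuG).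
Proof.
move=> genR symR genS symS cnuG cnuH [T [gen [rels [genT relsP]]]] [act0 tact0].
have [word wordK] := choice genT.
have dominate (B : finType) (Y : set (config H B)) : sofic Y -> Y !=set0 ->
    exists (A : finType) (X : set (config G A)), [/\ SFT X, X !=set0 &
      degree_le (subshift_degree nuH Y) (subshift_degree nuG X)].
  move=> [_ [C [Z [f [sftZ cf fM ->]]]]] [_ [z Zz _]].
  have [[subZ _] ract] := (sftZ, let: And3 ract _ _ := tact0 in ract).
  have [J _ actJ] := displacement_fset genS tact0 (eval_letter gen).
  have [rep [repE repM]] := exists_orbit_representative tact0.
  have [c _ cM] := exists_cocycle tact0 repE repM.
  exists ({ffun T * bool -> J} * C)%type, (lift_subshift rels word (J := J) Z); split.
  - exact: (@lift_SFT G H T gen rels word J wordK relsP _ _ sftZ).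
  - by exists (orbit_copy z c actJ); apply: (lift_copy wordK relsP ract actJ cM) => //; case: subZ.
  - do 2!eexists; split; [reflexivity|reflexivity|].
    apply: medvedev_le_trans (medvedev_le_image genS cnuH subZ cf fM) _.
    exact: (@medvedev_le_lift G H R S nuG nuH genR cnuG cnuH T gen rels word J wordK relsP).
split; [split=> //|].
  move=> [B [Y [sofY Y0 degY]]]; have [A [X [sftX X0 leX]]] := dominate B Y sofY Y0.
  exists A, X; split=> //; first exact: sofic_SFT.
  by move=> degX; apply/degY/degree_le_zero; rewrite -degX.
move=> recG [act [tact cact dact]].
have ract : right_action act by case: tact.
have [J J1 actJ] := displacement_fset genS tact (eval_letter gen).
have [c [cM [h ch hE]]] :=
  computable_cocycle genR genS symR symS cnuG cnuH recG tact cact dact.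
have ctau a := computable_displacement genR genS symR symS cnuG recG cact (actJ a).
have leG (B : finType) (Y : set (config H B)) X :=
  @medvedev_le_copy G H R S nuG nuH T gen J B act c actJ J1 Y X h ctau ch hE.
have leH (B : finType) (Y : set (config H B)) :=
  @medvedev_le_lift G H R S nuG nuH genR cnuG cnuH T gen rels word J wordK relsP B Y.
split=> _ [B [Y [shY [y Yy] ->]]].
  have [[_ YM] _] := shY.
  exists ({ffun T * bool -> J} * B)%type, (lift_subshift rels word (J := J) Y).
  split; first exact: (@lift_SFT G H T gen rels word J wordK relsP _ _ shY).
    by exists (orbit_copy y c actJ); exact: (lift_copy wordK relsP ract actJ cM).
  apply: degree_ofE; first exact: leH.
  by apply: leG => z Yz; exact: (lift_copy wordK relsP ract actJ cM).
have [_ [C [Z [f [sftZ cf fM YE]]]]] := shY; have [[_ ZM] _] := sftZ.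
(* The lift of [Z] need not map onto the lift of [Y]: orbits may be non-free, and a
   periodic point of [Y] need not have a periodic preimage in [Z]. The image of
   the lift of [Z] is a smaller subshift, which still contains the copies of
   the points of [Y]. *)
pose L := lift_subshift rels word (J := J) Z.
have liftf : lift_map word f @` L `<=` lift_subshift rels word (f @` Z).
  by move=> _ [x Lx <-]; exact: (lift_lift_map wordK relsP fM).
have copyL z : Y z -> (lift_map word f @` L) (orbit_copy z c actJ).
  rewrite YE => -[u Zu <-]; exists (orbit_copy u c actJ).
    exact: (lift_copy wordK relsP ract actJ cM).
  exact: (lift_map_copy wordK fM actJ ract cM).
exists ({ffun T * bool -> J} * B)%type, (lift_map word f @` L); split.
- apply: sofic_image; first exact: (@lift_SFT G H T gen rels word J wordK relsP _ _ sftZ).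
    exact: continuous_lift_map.
  by move=> g x _; exact: lift_map_shift.
- by exists (orbit_copy y c actJ); exact: copyL.
apply: degree_ofE; last exact: leG.
apply: medvedev_le_trans (leH B Y) _; apply: medvedev_le_subset.
by rewrite YE; do 2!apply: image_subset.
Qed.
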